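(* Let $f,g:B_R\to\mathbb{O}$ be regular functions, not identically zero, and let $\alpha\in B_R$ be a non-real octonion. Let $r_\alpha(f)(w)=w\,a+b$ and $r_\alpha(g)(w)=w\,c+d$ be the remainders of $f$ and $g$ with respect to $\alpha$, where $a,b,c,d\in\mathbb{O}$. The following statements hold. (1) Suppose that $\alpha$ is an isolated zero of $f$ of multiplicity $s$ and $g$ is nowhere zero on $\mathbb{S}_\alpha$. Then $f\ast g$ has an isolated zero $\alpha'$ in $\mathbb{S}_\alpha$ of multiplicity $s$, $ad+(\overline\alpha a)c\ne 0$, and $$\alpha'=\big((\alpha a)d+n_\alpha\,ac\big)\big(ad+(\overline\alpha a)c\big)^{-1}.$$ In particular, if $(\alpha a)d=\alpha(ad)$ and $n_\alpha\,ac=\alpha\big((\overline\alpha a)c\big)$ (for example, if $a$ is real or if $a,b,c,d$ belong to an associative subalgebra of $\mathbb{O}$), then $\alpha'=\alpha$. (2) Suppose that $f$ is nowhere zero on $\mathbb{S}_\alpha$ and $g$ has an isolated zero $\beta$ in $\mathbb{S}_\alpha$ of multiplicity $t$. Then $f\ast g$ has an isolated zero $\beta'$ in $\mathbb{S}_\alpha$ of multiplicity $t$, $bc+a(\overline\beta c)\neq 0$, and $$\beta'=\big(b(\beta c)+n_\alpha\,ac\big)\big(bc+a(\overline\beta c)\big)^{-1}.$$ In particular, if $b(\beta c)=(b\beta)c$ and $a(\overline\beta c)=(a\overline\beta)c$ (for example, if $c$ is real or if $a,b,c,d$ belong to an associative subalgebra of $\mathbb{O}$), then $\beta'=(b+a\overline\beta)\,\beta\,(b+a\overline\beta)^{-1}$.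 (3) Suppose that $\alpha$ is an isolated zero of $f$ of multiplicity $s$ and $g$ has an isolated zero $\beta$ in $\mathbb{S}_\alpha$ of multiplicity $t$. If $a(\beta c)=(\overline\alpha a)c$, then $\alpha$ is a spherical zero of $f\ast g$ of multiplicity $s+t$. Otherwise, $f\ast g$ has an isolated zero $\gamma$ in $\mathbb{S}_\alpha$ of multiplicity $s+t$ such that $$\gamma=\big(-(\alpha a)(\beta c)+n_\alpha\,ac\big)\big(-a(\beta c)+(\overline\alpha a)c\big)^{-1}.$$ (4) Suppose that $\alpha$ is a spherical zero of $f$ or of $g$, and let $s=m_f(\alpha)$, $t=m_g(\alpha)$ be the respective multiplicities of $\alpha$ (possibly zero). Then $\alpha$ is a spherical zero of $f\ast g$ of multiplicity $s+t$.
   Context: $\mathbb{O}$ is the real alternative division algebra of octonions (an octonion is non-real if it is not in $\mathbb{R}$), $\overline{x}$ is octonionic conjugation, $|x|$ the norm. $B_R$ is the open ball of $\mathbb{O}$ centered at the origin with radius $R\in(0,+\infty]$. A function $f:B_R\to\mathbb{O}$ is (slice) regular if it is given by a power series $f(w)=\sum_{i\ge 0} w^i a_i$ with coefficients $a_i\in\mathbb{O}$ on the right, converging in $B_R$. For regular $f=\sum_i w^ia_i$, $g=\sum_j w^jb_j$ on $B_R$, the product is the regular function $(f\ast g)(w)=\sum_k w^k\big(\sum_{i+j=k}a_ib_j\big)$; when $f$ has real coefficients one writes $fg$ for $f\ast g$. Put $\overline{f}(w)=\sum_i w^i\overline{a}_i$ and $N(f):=f\ast\overline f=\overline f\ast f$,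 which is regular on $B_R$ with real coefficients. For $\alpha\in\mathbb{O}$ put $t_\alpha=\alpha+\overline\alpha$, $n_\alpha=|\alpha|^2$, and $\Delta_\alpha(w)=w^2-w\,t_\alpha+n_\alpha$, a real polynomial. $\mathbb{S}_\alpha=\{\mathrm{Re}(\alpha)+|\mathrm{Im}(\alpha)|\,I : I\in\mathbb{O},\ I^2=-1\}$ is the conjugacy class of $\alpha$; $\Delta_\alpha=\Delta_\beta$ iff $\beta\in\mathbb{S}_\alpha$. For $\alpha\in B_R$ non-real, there are a unique regular function $h$ on $B_R$ and unique $a,b\in\mathbb{O}$ with $f=\Delta_\alpha h+w\,a+b$; the polynomial $r_\alpha(f)(w)=w\,a+b$ is called the remainder of $f$ with respect to $\alpha$ (it depends only on $\mathbb{S}_\alpha$). $V(f)$ is the zero set of $f$ in $B_R$. A non-real $\alpha$ with $\mathbb{S}_\alpha\subset V(f)$ is a spherical zero of $f$; a non-real $\alpha\in V(f)$ with $\mathbb{S}_\alpha\not\subset V(f)$ is an isolated zero of $f$. For real power series $p,q$ regular on $B_R$, $p\mid q$ means $q=p\,h$ for some regular $h$ on $B_R$. For $f$ not identically zero and $\alpha\in B_R$, the multiplicity $m_f(\alpha)$ is the non-negative integer $s$ such that $\Delta_\alpha^s\mid N(f)$ and $\Delta_\alpha^{s+1}\nmid N(f)$; it depends only on $\mathbb{S}_\alpha$, and a zero $\alpha$ of $f$ is said to have multiplicity $s$ if $m_f(\alpha)=s$. Expressions such as $n_\alpha\,ac$ mean $n_\alpha(ac)$. *)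

(* Defs.v *)
From HB Require Import structures.
From mathcomp Require Import all_boot all_order all_algebra.
From mathcomp Require Import all_classical all_reals all_analysis.

Set Implicit Arguments.
Unset Strict Implicit.
Unset Printing Implicit Defensive.

Import Order.TTheory GRing.Theory Num.Theory.
Import numFieldNormedType.Exports.

Local Open Scope classical_set_scope.
Local Open Scope ring_scope.

Definition cd_conj (A : zmodType) (cj : A -> A) (x : A * A) : A * A :=
  (cj x.1, - x.2).

Definition cd_mul (A : zmodType) (cj : A -> A) (mul : A -> A -> A)
    (x y : A * A) : A * A :=
  (mul x.1 y.1 - mul (cj y.2) x.2, mul y.2 x.1 + mul x.2 (cj y.1)).

(* The octonions are obtained from R by three Cayley-Dickson doublings; the
   additive group and the topology are those of the product R^8. The library
   also puts on this product a componentwise multiplication, a componentwise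
   unit and a sup norm: these are NOT the octonionic ones, which are [oct_mul]
   (written [**]), [1%:O] and [oct_norm] below. *)
Definition octonion (R : realType) : Type :=
  (((R * R) * (R * R)) * ((R * R) * (R * R)))%type.

HB.instance Definition _ (R : realType) :=
  NormedModule.copy (octonion R)
    (((R * R) * (R * R)) * ((R * R) * (R * R)))%type.

Section Octonions.
Variable R : realType.

Definition oct_conj : octonion R -> octonion R :=
  cd_conj (cd_conj (cd_conj (@id R))).

Definition oct_mul : octonion R -> octonion R -> octonion R :=
  cd_mul (cd_conj (cd_conj (@id R)))
    (cd_mul (cd_conj (@id R)) (cd_mul (@id R) *%R)).

Definition oct_real (r : R) : octonion R :=
  (((r, 0), (0, 0)), ((0, 0), (0, 0))).

Definition oct_Re (x : octonion R) : R := x.1.1.1.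

Definition oct_Im (x : octonion R) : octonion R := x - oct_real (oct_Re x).

Definition oct_norm (x : octonion R) : R := Num.sqrt (oct_Re (oct_mul x (oct_conj x))).

Definition oct_inv (x : octonion R) : octonion R :=
  oct_mul (oct_real (oct_norm x ^- 2)) (oct_conj x).

Definition oct_pow (x : octonion R) (n : nat) : octonion R :=
  iter n (oct_mul x) (oct_real 1).

Definition oct_is_real (x : octonion R) : Prop := exists r : R, x = oct_real r.

End Octonions.

Declare Scope oct_scope.
Delimit Scope oct_scope with O.
Notation "x ** y" := (oct_mul x y) (at level 40, left associativity) : oct_scope.
Notation "r %:O" := (oct_real r) (at level 1, format "r %:O") : oct_scope.
Local Open Scope oct_scope.

(* The unit 1 is not required, and is automatic as soon as A <> {0}. *)
Definition associative_subalgebra (R : realType) (A : set (octonion R)) :=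
  [/\ A 0,
      forall x y, A x -> A y -> A (x + y),
      forall (r : R) x, A x -> A (r%:O ** x),
      forall x y, A x -> A y -> A (x ** y) &
      forall x y z, A x -> A y -> A z -> (x ** y) ** z = x ** (y ** z)].

Section RegularFunctions.
Variables (R : realType) (rho : \bar R).
Local Notation O := (octonion R).

Definition oct_ball : set O := [set w | ((oct_norm w)%:E < rho)%E].

Definition oct_series (a : nat -> O) (w : O) : nat -> O :=
  series (fun i => oct_pow w i ** a i).

(* Functions are total on the octonions, but only their values on [oct_ball]
   are ever constrained or used. *)
Definition expansion (f : O -> O) (a : nat -> O) : Prop :=
  forall w, oct_ball w -> oct_series a w @ \oo --> f w.

Definition regular (f : O -> O) : Prop := exists a, expansion f a.

Definition eq_on_ball (f g : O -> O) : Prop := forall w, oct_ball w -> f w = g w.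

Definition not_identically_zero (f : O -> O) : Prop :=
  exists2 w, oct_ball w & f w != 0.

(* The coefficients of a regular function are unique when 0 < rho. *)
Definition coef (f : O -> O) : nat -> O :=
  xget (fun=> 0) [set a | expansion f a].

Definition psum (a : nat -> O) (w : O) : O := lim (oct_series a w @ \oo).

Definition star (f g : O -> O) : O -> O :=
  psum (fun k => \sum_(i < k.+1) coef f i ** coef g (k - i)%N).

Definition star_exp (f : O -> O) (n : nat) : O -> O :=
  iter n (star f) (fun=> 1%:O).

Definition conj_fun (f : O -> O) : O -> O := psum (fun i => oct_conj (coef f i)).

Definition normal_fun (f : O -> O) : O -> O := star f (conj_fun f).

Definition divides (p q : O -> O) : Prop :=
  exists2 h, regular h & eq_on_ball q (star p h).

Definition oct_tr (al : O) : O := al + oct_conj al.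

Definition oct_nsq (al : O) : O := (oct_norm al ^+ 2)%:O.

Definition Delta (al : O) (w : O) : O := w ** w - w ** oct_tr al + oct_nsq al.

Definition conj_class (al : O) : set O :=
  [set w | exists2 I : O, I ** I = - 1%:O &
                          w = (oct_Re al)%:O + (oct_norm (oct_Im al))%:O ** I].

(* The pair (a, b) stands for the polynomial w a + b. It exists and is unique
   for f regular and al a non-real point of the ball, so that the default
   value is irrelevant. *)
Definition remainder (f : O -> O) (al : O) : O * O :=
  xget (0, 0) [set ab : O * O | exists2 h, regular h &
    eq_on_ball f (fun w => star (Delta al) h w + (w ** ab.1 + ab.2))].

Definition zero_set (f : O -> O) : set O := [set w | oct_ball w /\ f w = 0].

Definition spherical_zero (f : O -> O) (al : O) : Prop :=
  ~ oct_is_real al /\ conj_class al `<=` zero_set f.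

Definition isolated_zero (f : O -> O) (al : O) : Prop :=
  [/\ ~ oct_is_real al, zero_set f al & ~ (conj_class al `<=` zero_set f)].

(* The default value 0 is irrelevant for f regular, not identically zero: then
   exactly one s qualifies. Moreover an equality [multiplicity f al = s] with
   0 < s is never due to the default. *)
Definition multiplicity (f : O -> O) (al : O) : nat :=
  xget 0%N [set s | divides (star_exp (Delta al) s) (normal_fun f) /\
                    ~ divides (star_exp (Delta al) s.+1) (normal_fun f)].

End RegularFunctions.

(* Main.v *)
(* Write t = 2 Re(al), n = |al|^2. On S_al every w satisfies w^2 = t w - n, so a
   regular f takes there the values w a + b of its remainder: its zeros on S_al
   are all of S_al if a = b = 0, and at most the point -b a^-1 otherwise. The
   remainder of N(f) is w (t |a|^2 + 2 <a, b>) + |b|^2 - n |a|^2, which vanishes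
   exactly when a = b = 0 or -b a^-1 has the real part and the norm of al; so
   Delta divides N(f) if and only if f has a zero on S_al. Since Delta is central
   and w^2 = Delta + t w - n, the remainder of f * g is
   w (t ac + ad + bc) + (bd - n ac), and the formulas for the zeros of f * g follow
   by substituting b = -al a and/or d = -be c. Multiplicities add up because
   N(f * g) = N(f) N(g), an identity of power series which is the composition law
   of the octonions over a commutative ring, and because Delta is prime among real
   power series. They are finite: if q = Delta^s h, then replacing Delta by its
   Blaschke reflection changes no l^2 norm on the circle of radius r > |al|, which
   bounds the lowest coefficient of q by a constant times (|al| / r)^(2 s). *)

From HB Require Import structures.
Require Import Defs.
From mathcomp Require Import all_boot all_order all_algebra.
From mathcomp Require Import all_classical all_reals all_analysis.
From mathcomp Require Import ring lra.
Set Implicit Arguments.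
Unset Strict Implicit.
Unset Printing Implicit Defensive.
Import Order.TTheory GRing.Theory Num.Theory.
Import numFieldNormedType.Exports.
Local Open Scope classical_set_scope.
Local Open Scope ring_scope.
Local Open Scope oct_scope.

(** * Octonions over a commutative ring *)

(** The constant coefficient [n] of Delta is nonzero, so Delta is invertible as a formal power
    series and every sequence is formally a multiple of it. Divisibility carries information only
    because the quotient must converge in the ball. Regular functions are therefore replaced by
    their coefficient sequences with the growth condition [radial], multiplication by Delta becomes
    the operator [quadmul 1 (- t) n], and the analysis goes mainly into constructing a convergent
    quotient, evaluating it on a conjugacy class, and bounding the number of factors Delta. A second
    obstacle is that evaluation is not multiplicative and octonions do not associate. The zeros of a
    product are therefore read off its remainder rather than off the values of the factors. Delta
    has real coefficients and passes through every product, so the bracketing matters only in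
    products of remainder coefficients and points of the class. *)

Definition oct8 (A : Type) : Type := (((A * A) * (A * A)) * ((A * A) * (A * A)))%type.

(* Locked, lest rewriting with a formula about [mk8] unfold unrelated terms. *)
HB.lock Definition mk8 (A : Type) (x0 x1 x2 x3 x4 x5 x6 x7 : A) : oct8 A :=
  (((x0, x1), (x2, x3)), ((x4, x5), (x6, x7))).

Lemma oct8_ind (A : Type) (P : oct8 A -> Prop) :
  (forall x0 x1 x2 x3 x4 x5 x6 x7, P (mk8 x0 x1 x2 x3 x4 x5 x6 x7)) ->
  forall x, P x.
Proof.
move=> PP [[[x0 x1][x2 x3]][[x4 x5][x6 x7]]].
by have := PP x0 x1 x2 x3 x4 x5 x6 x7; rewrite mk8.unlock.
Qed.

(* [gconj] and [gmul] over R are convertible to [oct_conj] and [oct_mul]. *)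
Definition gconj (A : comPzRingType) : oct8 A -> oct8 A :=
  cd_conj (cd_conj (cd_conj (@id A))).

Definition gmul (A : comPzRingType) : oct8 A -> oct8 A -> oct8 A :=
  cd_mul (cd_conj (cd_conj (@id A)))
    (cd_mul (cd_conj (@id A)) (cd_mul (@id A) *%R)).

Section Coordinates.
Variable A : comPzRingType.

Let pairD (a b c d : A) : (a, b) + (c, d) = (a + c, b + d).
Proof. by []. Qed.
Let pairN (a b : A) : - (a, b) = (- a, - b).
Proof. by []. Qed.
Let pair2D (a b c d : A * A) : (a, b) + (c, d) = (a + c, b + d).
Proof. by []. Qed.
Let pair2N (a b : A * A) : - (a, b) = (- a, - b).
Proof. by []. Qed.
Let cdE (V : zmodType) (cj : V -> V) (m : V -> V -> V) (a b c d : V) :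
  cd_mul cj m (a, b) (c, d) = (m a c - m (cj d) b, m d a + m b (cj c)).
Proof. by []. Qed.
Let conjE (V : zmodType) (cj : V -> V) (a b : V) :
  cd_conj cj (a, b) = (cj a, - b).
Proof. by []. Qed.

Let cmulE (a b c d : A) :
  cd_mul (@id A) *%R (a, b) (c, d) = (a * c - d * b, d * a + b * c).
Proof. by []. Qed.

Let qmulE (a b c d a' b' c' d' : A) :
  cd_mul (cd_conj (@id A)) (cd_mul (@id A) *%R) ((a, b), (c, d)) ((a', b'), (c', d')) =
  ((a * a' - b * b' - c * c' - d * d', a * b' + b * a' + c * d' - d * c'),
   (c' * a - d' * b + a' * c + b' * d, c' * b + d' * a + a' * d - b' * c)).
Proof.
rewrite cdE !conjE !cmulE pairN !pairD.
by congr ((_, _), (_, _)); ring.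
Qed.

Lemma gmulE x0 x1 x2 x3 x4 x5 x6 x7 y0 y1 y2 y3 y4 y5 y6 y7 :
  gmul (mk8 x0 x1 x2 x3 x4 x5 x6 x7) (mk8 y0 y1 y2 y3 y4 y5 y6 y7) =
  mk8
   (x0 * y0 - x1 * y1 - x2 * y2 - x3 * y3 - x4 * y4 - x5 * y5 - x6 * y6 - x7 * y7)
   (x0 * y1 + x1 * y0 + x2 * y3 - x3 * y2 + x4 * y5 - x5 * y4 - x6 * y7 + x7 * y6)
   (x0 * y2 - x1 * y3 + x2 * y0 + x3 * y1 + x4 * y6 + x5 * y7 - x6 * y4 - x7 * y5)
   (x0 * y3 + x1 * y2 - x2 * y1 + x3 * y0 + x4 * y7 - x5 * y6 + x6 * y5 - x7 * y4)
   (x0 * y4 - x1 * y5 - x2 * y6 - x3 * y7 + x4 * y0 + x5 * y1 + x6 * y2 + x7 * y3)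
   (x0 * y5 + x1 * y4 - x2 * y7 + x3 * y6 - x4 * y1 + x5 * y0 - x6 * y3 + x7 * y2)
   (x0 * y6 + x1 * y7 + x2 * y4 - x3 * y5 - x4 * y2 + x5 * y3 + x6 * y0 - x7 * y1)
   (x0 * y7 - x1 * y6 + x2 * y5 + x3 * y4 - x4 * y3 - x5 * y2 + x6 * y1 + x7 * y0) :> oct8 A.
Proof.
rewrite mk8.unlock /gmul cdE !conjE !pairN !qmulE !pair2N !pairN !pair2D !pairD.
by congr (((_,_),(_,_)),((_,_),(_,_))); ring.
Qed.

Lemma gconjE x0 x1 x2 x3 x4 x5 x6 x7 :
  gconj (mk8 x0 x1 x2 x3 x4 x5 x6 x7) =
  mk8 x0 (- x1) (- x2) (- x3) (- x4) (- x5) (- x6) (- x7) :> oct8 A.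
Proof. by rewrite mk8.unlock. Qed.

(** Degen's eight-square identity is a polynomial identity in sixteen variables, hence valid over
    every commutative ring; it is used below over R[X], where it covers all coefficients of a power
    series at once. *)
Lemma gnormM (x y : oct8 A) :
  gmul (gmul x y) (gconj (gmul x y)) = gmul (gmul x (gconj x)) (gmul y (gconj y)).
Proof.
elim/oct8_ind: x => x0 x1 x2 x3 x4 x5 x6 x7.
elim/oct8_ind: y => y0 y1 y2 y3 y4 y5 y6 y7.
by rewrite !(gmulE, gconjE); congr mk8; ring.
Qed.

End Coordinates.

(** * Octonion algebra *)

Section OctonionAlgebra.
Variable R : realType.
Local Notation O := (octonion R).
Local Notation conj := (@oct_conj R).
Implicit Types (x y z : O) (r : R).

Definition oct_mulE (x0 x1 x2 x3 x4 x5 x6 x7 y0 y1 y2 y3 y4 y5 y6 y7 : R) :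
  (mk8 x0 x1 x2 x3 x4 x5 x6 x7 : O) ** (mk8 y0 y1 y2 y3 y4 y5 y6 y7 : O) = _ :=
  gmulE x0 x1 x2 x3 x4 x5 x6 x7 y0 y1 y2 y3 y4 y5 y6 y7.
Definition oct_conjE (x0 x1 x2 x3 x4 x5 x6 x7 : R) :
  conj (mk8 x0 x1 x2 x3 x4 x5 x6 x7 : O) = _ := gconjE x0 x1 x2 x3 x4 x5 x6 x7.
Lemma oct_addE (x0 x1 x2 x3 x4 x5 x6 x7 y0 y1 y2 y3 y4 y5 y6 y7 : R) :
  (mk8 x0 x1 x2 x3 x4 x5 x6 x7 : O) + (mk8 y0 y1 y2 y3 y4 y5 y6 y7 : O) =
  mk8 (x0 + y0) (x1 + y1) (x2 + y2) (x3 + y3) (x4 + y4) (x5 + y5) (x6 + y6) (x7 + y7).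
Proof. by rewrite mk8.unlock. Qed.
Lemma oct_oppE (x0 x1 x2 x3 x4 x5 x6 x7 : R) :
  - (mk8 x0 x1 x2 x3 x4 x5 x6 x7 : O) =
  mk8 (- x0) (- x1) (- x2) (- x3) (- x4) (- x5) (- x6) (- x7).
Proof. by rewrite mk8.unlock. Qed.
Lemma oct_scaleE r (x0 x1 x2 x3 x4 x5 x6 x7 : R) :
  r *: (mk8 x0 x1 x2 x3 x4 x5 x6 x7 : O) =
  mk8 (r * x0) (r * x1) (r * x2) (r * x3) (r * x4) (r * x5) (r * x6) (r * x7).
Proof. by rewrite mk8.unlock. Qed.
Lemma oct_realE r : r%:O = mk8 r 0 0 0 0 0 0 0.
Proof. by rewrite mk8.unlock. Qed.
Lemma oct_ReE (x0 x1 x2 x3 x4 x5 x6 x7 : R) :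
  oct_Re (mk8 x0 x1 x2 x3 x4 x5 x6 x7 : O) = x0.
Proof. by rewrite mk8.unlock. Qed.
Definition octE := (oct_mulE, oct_conjE, oct_addE, oct_oppE, oct_scaleE, oct_realE, oct_ReE).

Local Ltac octring :=
  repeat match goal with |- forall _, _ => let x := fresh "x" in intro x end;
  repeat match goal with x : octonion _ |- _ =>
    revert x; refine (oct8_ind _); intros ? ? ? ? ? ? ? ? end;
  rewrite !octE; try congr mk8; ring.

Definition oct_nsqr x : R := oct_Re (x ** conj x).
Definition oct_dot x y : R := oct_Re (x ** conj y).
Definition oct_assoc x y z : O := (x ** y) ** z - x ** (y ** z).

Lemma oct_mulDl x y z : (x + y) ** z = x ** z + y ** z. Proof. octring. Qed.
Lemma oct_mulDr x y z : z ** (x + y) = z ** x + z ** y. Proof. octring. Qed.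
Lemma oct_mulNl x y : (- x) ** y = - (x ** y). Proof. octring. Qed.
Lemma oct_mulNr x y : x ** (- y) = - (x ** y). Proof. octring. Qed.
Lemma oct_scaleAl r x y : (r *: x) ** y = r *: (x ** y). Proof. octring. Qed.
Lemma oct_scaleAr r x y : x ** (r *: y) = r *: (x ** y). Proof. octring. Qed.
Lemma oct_mul_reall r x : r%:O ** x = r *: x. Proof. octring. Qed.
Lemma oct_mul_realr r x : x ** r%:O = r *: x. Proof. octring. Qed.
Lemma oct_realZ r r' : r *: r'%:O = (r * r')%:O. Proof. octring. Qed.
Lemma oct_realD r r' : (r + r')%:O = r%:O + r'%:O. Proof. octring. Qed.
Lemma oct_realN r : (- r)%:O = - r%:O. Proof. octring. Qed.
Lemma oct_conjD x y : conj (x + y) = conj x + conj y. Proof. octring. Qed.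
Lemma oct_conjZ r x : conj (r *: x) = r *: conj x. Proof. octring. Qed.
Lemma oct_conjK x : conj (conj x) = x. Proof. octring. Qed.
Lemma oct_conjM x y : conj (x ** y) = conj y ** conj x. Proof. octring. Qed.
Lemma oct_mul_conjr x : x ** conj x = (oct_nsqr x)%:O.
Proof. rewrite /oct_nsqr; octring. Qed.
Lemma oct_add_conj x : x + conj x = (oct_Re x *+ 2)%:O. Proof. octring. Qed.
Lemma oct_dot_conj x y : x ** conj y + y ** conj x = (oct_dot x y *+ 2)%:O.
Proof. rewrite /oct_dot; octring. Qed.
Lemma oct_conj_mulKl x y : conj x ** (x ** y) = oct_nsqr x *: y.
Proof. rewrite /oct_nsqr; octring. Qed.
Lemma oct_mulK_conj x y : (y ** x) ** conj x = oct_nsqr x *: y.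
Proof. rewrite /oct_nsqr; octring. Qed.
Lemma oct_altl x y : x ** (x ** y) = (x ** x) ** y. Proof. octring. Qed.
Lemma oct_nsqrM x y : oct_nsqr (x ** y) = oct_nsqr x * oct_nsqr y.
Proof. rewrite /oct_nsqr; octring. Qed.
Lemma oct_nsqr_conj x : oct_nsqr (conj x) = oct_nsqr x.
Proof. rewrite /oct_nsqr; octring. Qed.
Lemma oct_nsqrN x : oct_nsqr (- x) = oct_nsqr x.
Proof. rewrite /oct_nsqr; octring. Qed.
Lemma oct_nsqrZ r x : oct_nsqr (r *: x) = r ^+ 2 * oct_nsqr x.
Proof. rewrite /oct_nsqr; octring. Qed.
Lemma oct_nsqr_real r : oct_nsqr r%:O = r ^+ 2.
Proof. rewrite /oct_nsqr; octring. Qed.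
Lemma oct_dotMl x y z : oct_dot (x ** y) (x ** z) = oct_nsqr x * oct_dot y z.
Proof. rewrite /oct_nsqr /oct_dot; octring. Qed.
Lemma oct_dotMr x y z : oct_dot (x ** z) (y ** z) = oct_dot x y * oct_nsqr z.
Proof. rewrite /oct_nsqr /oct_dot; octring. Qed.
Lemma oct_dotNl x y : oct_dot (- x) y = - oct_dot x y.
Proof. rewrite /oct_dot; octring. Qed.
Lemma oct_dot_mull x y : oct_dot (x ** y) y = oct_Re x * oct_nsqr y.
Proof. rewrite /oct_dot /oct_nsqr; octring. Qed.
Lemma oct_nsqrRe x : oct_nsqr x = oct_Re x ^+ 2 + oct_nsqr (oct_Im x).
Proof. rewrite /oct_nsqr /oct_Im; octring. Qed.
Lemma oct_Re_conj x : oct_Re (conj x) = oct_Re x. Proof. octring. Qed.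
Lemma oct_ReZ r x : oct_Re (r *: x) = r * oct_Re x. Proof. octring. Qed.
Lemma oct_ReD x y : oct_Re (x + y) = oct_Re x + oct_Re y. Proof. octring. Qed.
Lemma oct_sqr x : x ** x = (oct_Re x *+ 2) *: x - (oct_nsqr x)%:O.
Proof. rewrite /oct_nsqr; octring. Qed.

(** One case of the associator being alternating. With the two Moufang identities that follow,
    associators can later be handled without coordinates. *)
Lemma oct_assocC x y z : oct_assoc x y z = - oct_assoc y x z.
Proof. rewrite /oct_assoc; octring. Qed.
Lemma oct_assoc_mull x y z : oct_assoc x (x ** y) z = oct_assoc x y z ** x.
Proof. rewrite /oct_assoc; octring. Qed.
Lemma oct_assoc_mulr x y z : oct_assoc x (y ** x) z = x ** oct_assoc x y z.
Proof. rewrite /oct_assoc; octring. Qed.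

Lemma oct_nsqrE (x0 x1 x2 x3 x4 x5 x6 x7 : R) :
  oct_nsqr (mk8 x0 x1 x2 x3 x4 x5 x6 x7) =
  x0 ^+ 2 + x1 ^+ 2 + x2 ^+ 2 + x3 ^+ 2 + x4 ^+ 2 + x5 ^+ 2 + x6 ^+ 2 + x7 ^+ 2.
Proof. by rewrite /oct_nsqr !octE; ring. Qed.

Lemma oct_nsqr_ge0 x : 0 <= oct_nsqr x.
Proof.
elim/oct8_ind: x => x0 x1 x2 x3 x4 x5 x6 x7.
by rewrite oct_nsqrE !addr_ge0 ?sqr_ge0.
Qed.

Lemma oct_nsqr_eq0 x : (oct_nsqr x == 0) = (x == 0).
Proof.
have -> : (0 : O) = 0%:O by [].
elim/oct8_ind: x => x0 x1 x2 x3 x4 x5 x6 x7.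
rewrite oct_nsqrE !octE !paddr_eq0 ?addr_ge0 ?sqr_ge0 // !sqrf_eq0.
apply/idP/eqP => [|E].
  by move=> /andP[/andP[/andP[/andP[/andP[/andP[/andP[]]]]]]];
    do 8 move=> /eqP->.
have {E} : (((x0, x1), (x2, x3)), ((x4, x5), (x6, x7))) =
  (((0, 0), (0, 0)), ((0, 0), (0, 0))) by rewrite mk8.unlock in E.
by case=> -> -> -> -> -> -> -> ->; rewrite eqxx.
Qed.

(** Convergence refers to the sup norm of R^8, the ball to the Euclidean norm; this bound and the
    next one pass between the two. *)
Lemma oct_norm_sup x : `|x| <= oct_norm x.
Proof.
elim/oct8_ind: x => x0 x1 x2 x3 x4 x5 x6 x7.
have b (t s : R) : t ^+ 2 <= s -> `|t| <= Num.sqrt s.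
  by move=> ts; rewrite -sqrtr_sqr ler_wsqrtr.
rewrite /oct_norm -/(oct_nsqr _) oct_nsqrE mk8.unlock.
have := (sqr_ge0 x0, sqr_ge0 x1, sqr_ge0 x2, sqr_ge0 x3, sqr_ge0 x4, sqr_ge0 x5,
  sqr_ge0 x6, sqr_ge0 x7) => -[[[[[[[h0 h1] h2] h3] h4] h5] h6] h7].
by rewrite !prod_normE /= !ge_max !b //; lra.
Qed.

(** The Euclidean norm on R^8 is at most sqrt 8 times the sup norm, and 3 is a convenient bound for
    sqrt 8. *)
Lemma oct_norm_le_sup x : oct_norm x <= 3 * `|x|.
Proof.
elim/oct8_ind: x => x0 x1 x2 x3 x4 x5 x6 x7.
set m := `|_|; have m0 : 0 <= m by exact: normr_ge0.
rewrite /oct_norm -/(oct_nsqr _) oct_nsqrE.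
have b (t : R) : `|t| <= m -> t ^+ 2 <= m ^+ 2.
  by move=> tm; rewrite -real_normK ?num_real // lerXn2r ?nnegrE.
have : [/\ `|x0| <= m, `|x1| <= m, `|x2| <= m & `|x3| <= m] /\
         [/\ `|x4| <= m, `|x5| <= m, `|x6| <= m & `|x7| <= m].
  by rewrite /m mk8.unlock !prod_normE /= !le_max !lexx /= ?orbT; do !split.
move=> [[/b h0 /b h1 /b h2 /b h3] [/b h4 /b h5 /b h6 /b h7]].
rewrite -(@ger0_norm _ (3 * m)) ?mulr_ge0 // -sqrtr_sqr ler_wsqrtr //.
by have := sqr_ge0 m; rewrite exprMn; lra.
Qed.

End OctonionAlgebra.

(** * Division, the norm and conjugacy classes *)

Section OctonionDivision.
Variable R : realType.
Local Notation O := (octonion R).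
Local Notation conj := (@oct_conj R).
Implicit Types (x y z w al : O) (r : R).

Lemma oct_mul0l x : 0 ** x = 0.
Proof. by rewrite -[0](scale0r (1%:O : O)) oct_scaleAl !scale0r. Qed.
Lemma oct_mul0r x : x ** 0 = 0.
Proof. by rewrite -[0](scale0r (1%:O : O)) oct_scaleAr !scale0r. Qed.
Lemma oct_mulBl x y z : (x - y) ** z = x ** z - y ** z.
Proof. by rewrite oct_mulDl oct_mulNl. Qed.
Lemma oct_mulBr x y z : z ** (x - y) = z ** x - z ** y.
Proof. by rewrite oct_mulDr oct_mulNr. Qed.

Lemma oct_conj0 : conj 0 = 0.
Proof. by rewrite -[0](scale0r (1%:O : O)) oct_conjZ !scale0r. Qed.
Lemma oct_conj_sum I (r : seq I) (P : pred I) (F : I -> O) :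
  conj (\sum_(i <- r | P i) F i) = \sum_(i <- r | P i) conj (F i).
Proof. by apply: (big_morph conj) => [y z|]; rewrite (oct_conjD, oct_conj0). Qed.

Lemma oct_mul_conjl x : conj x ** x = (oct_nsqr x)%:O.
Proof. by rewrite -{2}[x]oct_conjK oct_mul_conjr oct_nsqr_conj. Qed.
Lemma oct_mul_conjK x y : x ** (conj x ** y) = oct_nsqr x *: y.
Proof. by rewrite -{1}[x]oct_conjK oct_conj_mulKl oct_nsqr_conj. Qed.

Lemma oct_mul_eq0 x y : x ** y = 0 -> x = 0 \/ y = 0.
Proof.
move=> /eqP; rewrite -oct_nsqr_eq0 oct_nsqrM mulf_eq0 !oct_nsqr_eq0.
by case/orP => /eqP ->; [left|right].
Qed.

Lemma oct_invE x : oct_inv x = (oct_nsqr x)^-1 *: conj x.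
Proof.
by rewrite /oct_inv oct_mul_reall /oct_norm -/(oct_nsqr x) sqr_sqrtr ?oct_nsqr_ge0.
Qed.

(** Right division works without associativity, because alternativity turns multiplication by [y]
    followed by its conjugate into the real scalar [oct_nsqr y]. *)
Lemma oct_mulK x y : y != 0 -> (x ** y) ** oct_inv y = x.
Proof.
rewrite -oct_nsqr_eq0 => y0.
by rewrite oct_invE oct_scaleAr oct_mulK_conj scalerA mulVf ?scale1r.
Qed.
Lemma oct_mulVK x y : y != 0 -> (x ** oct_inv y) ** y = x.
Proof.
rewrite -oct_nsqr_eq0 => y0.
rewrite oct_invE oct_scaleAr oct_scaleAl; have := oct_mulK_conj (conj y) x.
by rewrite oct_conjK oct_nsqr_conj => ->; rewrite scalerA mulVf ?scale1r.
Qed.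

Lemma oct_norm_ge0 x : 0 <= oct_norm x. Proof. exact: sqrtr_ge0. Qed.
Lemma oct_norm_sqr x : oct_norm x ^+ 2 = oct_nsqr x.
Proof. by rewrite sqr_sqrtr ?oct_nsqr_ge0. Qed.
Lemma oct_normM x y : oct_norm (x ** y) = oct_norm x * oct_norm y.
Proof. by rewrite /oct_norm -!/(oct_nsqr _) oct_nsqrM sqrtrM ?oct_nsqr_ge0. Qed.
Lemma oct_norm_real r : oct_norm r%:O = `|r|.
Proof. by rewrite /oct_norm -/(oct_nsqr _) oct_nsqr_real sqrtr_sqr. Qed.
Lemma oct_norm_pow x n : oct_norm (oct_pow x n) = oct_norm x ^+ n.
Proof.
elim: n => [|n IH]; first by rewrite oct_norm_real normr1.
by rewrite /oct_pow iterS oct_normM -/(oct_pow x n) IH exprS.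
Qed.
Lemma oct_powS x n : oct_pow x n.+1 = x ** oct_pow x n. Proof. by []. Qed.
Lemma oct_pow_real r n : oct_pow r%:O n = (r ^+ n)%:O.
Proof.
elim: n => [|n IH]; first by [].
by rewrite oct_powS IH oct_mul_reall oct_realZ exprS.
Qed.
Lemma oct_norm_conj x : oct_norm (conj x) = oct_norm x.
Proof. by rewrite /oct_norm -!/(oct_nsqr _) oct_nsqr_conj. Qed.
Lemma oct_norm_eq x y : oct_nsqr x = oct_nsqr y -> oct_norm x = oct_norm y.
Proof. by rewrite /oct_norm -!/(oct_nsqr _) => ->. Qed.

Lemma oct_nonreal_neq0 al : ~ oct_is_real al -> al != 0.
Proof. by move=> H; apply/eqP => E; apply: H; exists 0; rewrite E. Qed.

Lemma conj_classE al w : conj_class al w ->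
  oct_Re w = oct_Re al /\ oct_nsqr w = oct_nsqr al.
Proof.
case=> I I2 ->; rewrite oct_mul_reall.
have n1 : oct_nsqr I = 1.
  have := congr1 (@oct_nsqr R) I2; rewrite oct_nsqrM oct_nsqrN oct_nsqr_real.
  rewrite -expr2 => /eqP; rewrite eqrXn2 ?oct_nsqr_ge0 //; by move/eqP.
(* By [oct_sqr], the square of [I] is 2 Re(I) I - 1; comparison with -1 leaves 2 Re(I) I = 0. *)
have r0 : oct_Re I = 0.
  move: I2; rewrite oct_sqr n1 -[X in _ = X]add0r => /addIr /eqP.
  rewrite scaler_eq0 => /orP[|/eqP I0]; first by rewrite mulrn_eq0 => /eqP.
  by rewrite I0.
have Reb : oct_Re ((oct_Re al)%:O + oct_norm (oct_Im al) *: I) = oct_Re al.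
  by rewrite oct_ReD oct_ReZ r0 mulr0 addr0.
split=> //; rewrite oct_nsqrRe Reb (oct_nsqrRe al) /oct_Im Reb.
by rewrite addrAC subrr add0r oct_nsqrZ n1 mulr1 oct_norm_sqr.
Qed.

(** Real part and norm are the data contained in Delta; membership in the class is used below in
    this form. *)
Lemma conj_classP al w : ~ oct_is_real al ->
  conj_class al w <-> oct_Re w = oct_Re al /\ oct_nsqr w = oct_nsqr al.
Proof.
move=> nr; split; first exact: conj_classE.
move=> [Ew nw].
have Im0 : oct_norm (oct_Im al) != 0.
  rewrite -(sqrf_eq0 (oct_norm _)) oct_norm_sqr oct_nsqr_eq0 subr_eq0.
  by apply/eqP => E; apply: nr; exists (oct_Re al).
have nIm : oct_nsqr (oct_Im w) = oct_norm (oct_Im al) ^+ 2.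
  move: nw; rewrite (oct_nsqrRe w) (oct_nsqrRe al) Ew => /addrI ->.
  by rewrite oct_norm_sqr.
exists ((oct_norm (oct_Im al))^-1 *: oct_Im w).
  rewrite oct_sqr oct_ReZ (_ : oct_Re (oct_Im w) = 0).
    rewrite mulr0 mul0rn scale0r sub0r oct_nsqrZ nIm exprVn mulVf //.
    by rewrite expf_neq0.
  by rewrite /oct_Im oct_ReD -oct_realN subrr.
by rewrite oct_mul_reall scalerA mulfV // scale1r /oct_Im Ew addrC subrK.
Qed.

Lemma conj_class_refl al : ~ oct_is_real al -> conj_class al al.
Proof. by move=> nr; apply/conj_classP. Qed.

Lemma conj_class_conj al : ~ oct_is_real al -> conj_class al (conj al).
Proof. by move=> nr; apply/conj_classP; rewrite ?oct_Re_conj ?oct_nsqr_conj. Qed.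

Lemma oct_conj_neq al : ~ oct_is_real al -> conj al <> al.
Proof.
move=> nr E; apply: nr; exists (oct_Re al).
apply: (@scalerI _ _ 2%:R); first by rewrite pnatr_eq0.
by rewrite oct_realZ mulr_natl -oct_add_conj E scaler_nat mulr2n.
Qed.

Lemma conj_class_nonreal al w : ~ oct_is_real al -> conj_class al w ->
  ~ oct_is_real w.
Proof.
move=> nr /conj_classE[Ew nw] [r wr]; apply: nr; exists r.
move: Ew nw; rewrite wr oct_nsqr_real (_ : oct_Re r%:O = r) // => Er.
rewrite oct_nsqrRe -Er => /eqP.
rewrite -subr_eq0 opprD addrA subrr add0r oppr_eq0 oct_nsqr_eq0 subr_eq0.
by rewrite -Er => /eqP.
Qed.

Lemma conj_class_eq al be : ~ oct_is_real al -> conj_class al be ->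
  conj_class be = conj_class al.
Proof.
move=> nr cb; have nrb := conj_class_nonreal nr cb.
have [Eb nb] := conj_classE cb.
apply/seteqP; split=> w /conj_classE H; apply/conj_classP => //.
  by rewrite -Eb -nb.
by rewrite Eb nb.
Qed.

End OctonionDivision.

(** * Coefficient sequences *)

Section Sequences.
Variables (R : realType) (V : lmodType R).
Implicit Types (x y : nat -> V).

Definition sshift x : nat -> V := fun k => if k is k'.+1 then x k' else 0.

(* The coefficients of [(A w^2 + B w + C) x(w)]. *)
Definition quadmul (A B C : R) x : nat -> V :=
  C *: x + B *: sshift x + A *: sshift (sshift x).

Lemma sseqD x y k : (x + y) k = x k + y k. Proof. by []. Qed.
Lemma sseqN x k : (- x) k = - x k. Proof. by []. Qed.
Lemma sseqZ (r : R) x k : (r *: x) k = r *: x k. Proof. by []. Qed.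

Lemma sshiftD x y : sshift (x + y) = sshift x + sshift y.
Proof. by apply/funext => -[|k] //=; rewrite sseqD addr0. Qed.
Lemma sshiftZ (r : R) x : sshift (r *: x) = r *: sshift x.
Proof. by apply/funext => -[|k] //=; rewrite sseqZ scaler0. Qed.
Lemma quadmulE0 A B C x : quadmul A B C x 0%N = C *: x 0%N.
Proof. by rewrite /quadmul !sseqD !sseqZ /= !scaler0 !addr0. Qed.

Lemma quadmulD A B C x y :
  quadmul A B C (x + y) = quadmul A B C x + quadmul A B C y.
Proof.
rewrite /quadmul !sshiftD !scalerDr.
by rewrite [X in X + _ = _]addrACA; exact: addrACA.
Qed.

Lemma quadmulZ A B C (r : R) x : quadmul A B C (r *: x) = r *: quadmul A B C x.
Proof.
by rewrite /quadmul !sshiftZ !scalerDr !scalerA !(mulrC r).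
Qed.

Lemma quadmulN A B C x : quadmul A B C (- x) = - quadmul A B C x.
Proof. by rewrite -scaleN1r quadmulZ scaleN1r. Qed.

Lemma quadmulB A B C x y :
  quadmul A B C (x - y) = quadmul A B C x - quadmul A B C y.
Proof. by rewrite quadmulD quadmulN. Qed.

Lemma quadmul_shift A B C x :
  quadmul A B C (sshift x) = sshift (quadmul A B C x).
Proof. by rewrite /quadmul !sshiftD !sshiftZ. Qed.

Lemma quadmulC A B C A' B' C' x :
  quadmul A B C (quadmul A' B' C' x) = quadmul A' B' C' (quadmul A B C x).
Proof.
rewrite [quadmul A' B' C' x]/quadmul.
by rewrite 2![in LHS]quadmulD 3![in LHS]quadmulZ 3![in LHS]quadmul_shift.
Qed.

(** Coefficients are compared upwards: once the earlier entries vanish, only [C *: x k] survives at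
    index [k]. *)
Lemma quadmul_eq0 A B C x : C != 0 -> quadmul A B C x = 0 -> x = 0.
Proof.
move=> C0 /(congr1 (fun f => f _)) H; apply/funext => k.
elim/ltn_ind: k => k IH; have := H k; rewrite /quadmul !sseqD !sseqZ.
have -> : sshift x k = 0 by case: k IH {H} => //= k IH; rewrite IH.
have -> : sshift (sshift x) k = 0 by case: k IH {H} => [|[|k]] //= IH; rewrite IH.
by rewrite !scaler0 !addr0 => /eqP; rewrite scaler_eq0 (negPf C0) => /eqP.
Qed.

Lemma quadmul_inj A B C : C != 0 -> injective (quadmul A B C).
Proof.
move=> C0 x y E; apply/eqP; rewrite -subr_eq0; apply/eqP.
by apply: (quadmul_eq0 C0 (A := A) (B := B)); rewrite quadmulB E subrr.
Qed.

End Sequences.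

Lemma quadmul_morph (R : realType) (V W : lmodType R) (A B C : R)
    (phi : V -> W) (x : nat -> V) :
  phi 0 = 0 -> {morph phi : u v / u + v} ->
  (forall r u, phi (r *: u) = r *: phi u) ->
  phi \o quadmul A B C x = quadmul A B C (phi \o x).
Proof.
move=> p0 pD pZ; apply/funext => k.
rewrite /quadmul /= !sseqD !sseqZ !pD !pZ.
by case: k => [|[|k]] /=; rewrite ?p0.
Qed.

Section OctonionSequences.
Variable R : realType.
Local Notation O := (octonion R).
Local Notation conj := (@oct_conj R).
Implicit Types (a b : nat -> O).

Definition convol a b : nat -> O :=
  fun k => \sum_(i < k.+1) a i ** b (k - i)%N.

Definition sconst (u : O) : nat -> O := fun k => if k is 0%N then u else 0.

(** The polynomial w u + v, with the coefficients in the order used by [remainder]. *)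
Definition saffine (u v : O) : nat -> O := sconst v + sshift (sconst u).

Definition sconj a : nat -> O := conj \o a.

Definition snormal a := convol a (sconj a).

Lemma convolDl a a' b : convol (a + a') b = convol a b + convol a' b.
Proof.
apply/funext => k; rewrite sseqD /convol -big_split /=.
by apply: eq_bigr => i _; rewrite sseqD oct_mulDl.
Qed.
Lemma convolDr a b b' : convol a (b + b') = convol a b + convol a b'.
Proof.
apply/funext => k; rewrite sseqD /convol -big_split /=.
by apply: eq_bigr => i _; rewrite sseqD oct_mulDr.
Qed.
Lemma convolZl r a b : convol (r *: a) b = r *: convol a b.
Proof.
apply/funext => k; rewrite sseqZ /convol scaler_sumr.
by apply: eq_bigr => i _; rewrite sseqZ oct_scaleAl.
Qed.
Lemma convolZr r a b : convol a (r *: b) = r *: convol a b.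
Proof.
apply/funext => k; rewrite sseqZ /convol scaler_sumr.
by apply: eq_bigr => i _; rewrite sseqZ oct_scaleAr.
Qed.
Lemma convol_shiftl a b : convol (sshift a) b = sshift (convol a b).
Proof.
apply/funext => -[|k]; rewrite /convol big_ord_recl /= oct_mul0l add0r ?big_ord0 //.
Qed.
Lemma convol_shiftr a b : convol a (sshift b) = sshift (convol a b).
Proof.
apply/funext => -[|k]; first by rewrite /convol big_ord1 /= oct_mul0r.
rewrite /convol big_ord_recr /= subnn /= oct_mul0r addr0.
by apply: eq_bigr => -[i ik] _ /=; rewrite subSn // -ltnS.
Qed.
Lemma convol_constl u b : convol (sconst u) b = fun k => u ** b k.
Proof.
apply/funext => k; rewrite /convol big_ord_recl subn0 /= big1 ?addr0 // => i _.
by rewrite oct_mul0l.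
Qed.
Lemma convol_quadl A B C a b : convol (quadmul A B C a) b = quadmul A B C (convol a b).
Proof. apply: etrans (convolDl _ _ _) _; congr (_ + _).
  apply: etrans (convolDl _ _ _) _; congr (_ + _); first exact: convolZl.
  by apply: etrans (convolZl _ _ _) _; congr (_ *: _); exact: convol_shiftl.
apply: etrans (convolZl _ _ _) _; congr (_ *: _).
by apply: etrans (convol_shiftl _ _) _; congr sshift; exact: convol_shiftl.
Qed.
Lemma convol_quadr A B C a b : convol a (quadmul A B C b) = quadmul A B C (convol a b).
Proof. apply: etrans (convolDr _ _ _) _; congr (_ + _).
  apply: etrans (convolDr _ _ _) _; congr (_ + _); first exact: convolZr.
  by apply: etrans (convolZr _ _ _) _; congr (_ *: _); exact: convol_shiftr.
apply: etrans (convolZr _ _ _) _; congr (_ *: _).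
by apply: etrans (convol_shiftr _ _) _; congr sshift; exact: convol_shiftr.
Qed.

Lemma saffineE u v k :
  saffine u v k = if k is k'.+1 then (if k' is 0%N then u else 0) else v.
Proof. by case: k => [|[|k]]; rewrite /saffine sseqD /= ?addr0 ?add0r. Qed.

Lemma saffineB u v u' v' : saffine u v - saffine u' v' = saffine (u - u') (v - v').
Proof.
by apply/funext => -[|[|k]]; rewrite sseqD sseqN !saffineE // subrr.
Qed.

Lemma convol_affine (t n : R) u v u' v' :
  convol (saffine u v) (saffine u' v') =
  quadmul 1 (- t) n (sconst (u ** u')) +
  saffine (t *: (u ** u') + (u ** v' + v ** u')) (v ** v' - n *: (u ** u')).
Proof.
apply/funext => k; rewrite sseqD /quadmul !sseqD !sseqZ saffineE.
case: k => [|[|[|k]]].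
- by rewrite /convol big_ord1 !saffineE /= !scaler0 !addr0 addrC subrK.
- rewrite /convol big_ord_recl big_ord1 !saffineE /= !scaler0 addr0 add0r scaleNr.
  by rewrite addrA addNr add0r addrC.
- rewrite /convol !big_ord_recl big_ord0 !saffineE /= !scaler0 scale1r.
  by rewrite oct_mul0l oct_mul0r !addr0 !add0r.
rewrite /convol 2!big_ord_recl !saffineE /= !scaler0 !addr0 !oct_mul0r !add0r.
by apply: big1 => i _; rewrite saffineE /= oct_mul0l.
Qed.

Lemma sconj_convol a b : sconj (convol a b) = convol (sconj b) (sconj a).
Proof.
apply/funext => k; rewrite /sconj /convol /= oct_conj_sum.
rewrite (reindex_inj rev_ord_inj) /=; apply: eq_bigr => -[i ik] _ /=.
by rewrite oct_conjM subSS subKn.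
Qed.
Lemma sconjK a : sconj (sconj a) = a.
Proof. by apply/funext => k; rewrite /sconj /= oct_conjK. Qed.
Lemma sconj_normal a : sconj (snormal a) = snormal a.
Proof. by rewrite /snormal sconj_convol sconjK. Qed.
Lemma sconj_quad A B C a : sconj (quadmul A B C a) = quadmul A B C (sconj a).
Proof.
apply: quadmul_morph; [exact: oct_conj0|exact: oct_conjD|exact: oct_conjZ].
Qed.
Lemma sconjD a b : sconj (a + b) = sconj a + sconj b.
Proof. by apply/funext => k; rewrite /sconj /= !sseqD oct_conjD. Qed.
Lemma sconj_affine u v : sconj (saffine u v) = saffine (conj u) (conj v).
Proof. by apply/funext => -[|[|k]]; rewrite /sconj /= !saffineE // oct_conj0. Qed.

(** If [a] vanishes below [k], the coefficient of index 2 k of the normal sequence has the single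
    surviving term |a_k|^2. *)
Lemma snormal_eq0 a : snormal a = 0 -> a = 0.
Proof.
move=> N0; apply/funext => k; elim/ltn_ind: k => k IH.
have := congr1 (fun f => f (k + k)%N) N0; rewrite /= /snormal /convol.
have kk : (k < (k + k).+1)%N by rewrite ltnS leq_addr.
rewrite (bigD1 (Ordinal kk)) //=.
rewrite big1 ?addr0; last first.
  move=> i; rewrite -val_eqE /= => ik.
  have [ik'|ki] := ltnP i k; first by rewrite IH // oct_mul0l.
  have {ik} ki : (k < i)%N by rewrite ltn_neqAle eq_sym ik.
  rewrite /sconj /= [a (k + k - i)%N]IH ?oct_conj0 ?oct_mul0r //.
  by case: i ki => i /= ik ki; rewrite ltn_subLR // ltn_add2r.
rewrite addnK /sconj /= oct_mul_conjr => /(congr1 (@oct_Re R)) /eqP.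
by rewrite [X in X == _]/= oct_nsqr_eq0 => /eqP.
Qed.

End OctonionSequences.

(** * Multiplicativity of the normal function *)

Section NormalMultiplicative.
Variable R : realType.
Local Notation O := (octonion R).
Local Notation conj := (@oct_conj R).

Let coefO (k : nat) (P : oct8 {poly R}) : O :=
  mk8 P.1.1.1`_k P.1.1.2`_k P.1.2.1`_k P.1.2.2`_k
      P.2.1.1`_k P.2.1.2`_k P.2.2.1`_k P.2.2.2`_k.

Let coefO_mk8 k (p0 p1 p2 p3 p4 p5 p6 p7 : {poly R}) :
  coefO k (mk8 p0 p1 p2 p3 p4 p5 p6 p7) =
  mk8 p0`_k p1`_k p2`_k p3`_k p4`_k p5`_k p6`_k p7`_k.
Proof. by rewrite /coefO mk8.unlock. Qed.

Let sum_mk8 n (F0 F1 F2 F3 F4 F5 F6 F7 : 'I_n -> R) :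
  \sum_(i < n) (mk8 (F0 i) (F1 i) (F2 i) (F3 i) (F4 i) (F5 i) (F6 i) (F7 i) : O) =
  mk8 (\sum_(i < n) F0 i) (\sum_(i < n) F1 i) (\sum_(i < n) F2 i) (\sum_(i < n) F3 i)
      (\sum_(i < n) F4 i) (\sum_(i < n) F5 i) (\sum_(i < n) F6 i) (\sum_(i < n) F7 i).
Proof.
elim: n F0 F1 F2 F3 F4 F5 F6 F7 => [|n IH] *.
  by rewrite !big_ord0 mk8.unlock.
by rewrite !big_ord_recr /= IH oct_addE.
Qed.

Let coefO_mul k (P Q : oct8 {poly R}) :
  coefO k (gmul P Q) = \sum_(i < k.+1) coefO i P ** coefO (k - i) Q.
Proof.
elim/oct8_ind: P => p0 p1 p2 p3 p4 p5 p6 p7.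
elim/oct8_ind: Q => q0 q1 q2 q3 q4 q5 q6 q7.
rewrite gmulE coefO_mk8; under eq_bigr do rewrite !coefO_mk8 oct_mulE.
by rewrite sum_mk8; congr mk8; rewrite !(coefB, coefD, coefM) !(sumrB, big_split).
Qed.

Let coefO_conj k (P : oct8 {poly R}) : coefO k (gconj P) = conj (coefO k P).
Proof.
elim/oct8_ind: P => p0 p1 p2 p3 p4 p5 p6 p7.
by rewrite gconjE !coefO_mk8 oct_conjE !coefN.
Qed.

(* [a] modulo [w^n], as an octonion over R[X]. *)
Let trunc (n : nat) (a : nat -> O) : oct8 {poly R} :=
  mk8 (\poly_(i < n) (a i).1.1.1) (\poly_(i < n) (a i).1.1.2)
      (\poly_(i < n) (a i).1.2.1) (\poly_(i < n) (a i).1.2.2)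
      (\poly_(i < n) (a i).2.1.1) (\poly_(i < n) (a i).2.1.2)
      (\poly_(i < n) (a i).2.2.1) (\poly_(i < n) (a i).2.2.2).

Let coefO_trunc n a k : (k < n)%N -> coefO k (trunc n a) = a k.
Proof.
move=> kn; rewrite /trunc coefO_mk8 !coef_poly kn.
by elim/oct8_ind: (a k) => *; rewrite mk8.unlock.
Qed.

(** Agreement below [n] is enough, since the coefficient of index [k] of a product involves only
    indices up to [k]; this makes truncation harmless. *)
Let coefO_convol n (a b : nat -> O) P Q k : (k < n)%N ->
  (forall k, (k < n)%N -> coefO k P = a k) ->
  (forall k, (k < n)%N -> coefO k Q = b k) ->
  coefO k (gmul P Q) = convol a b k.
Proof.
move=> kn Pa Qb; rewrite coefO_mul; apply: eq_bigr => -[i ik] _ /=.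
by rewrite Pa ?Qb //; [apply: leq_ltn_trans kn; exact: leq_subr|
  apply: leq_ltn_trans kn].
Qed.

(* The identity between the coefficients of [w^k] is that of the octonions over
   the commutative ring R[X], for the truncations of [a] and [b]. *)
Lemma snormal_convol (a b : nat -> O) :
  snormal (convol a b) = convol (snormal a) (snormal b).
Proof.
apply/funext => k; pose A := trunc k.+1 a; pose B := trunc k.+1 b.
have Aa i : (i < k.+1)%N -> coefO i A = a i by exact: coefO_trunc.
have Bb i : (i < k.+1)%N -> coefO i B = b i by exact: coefO_trunc.
have CJ P (c : nat -> O) : (forall i, (i < k.+1)%N -> coefO i P = c i) ->
    forall i, (i < k.+1)%N -> coefO i (gconj P) = sconj c i.
  by move=> Pc i ik; rewrite coefO_conj Pc.
have CM P Q (c d : nat -> O) : (forall i, (i < k.+1)%N -> coefO i P = c i) ->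
    (forall i, (i < k.+1)%N -> coefO i Q = d i) ->
    forall i, (i < k.+1)%N -> coefO i (gmul P Q) = convol c d i.
  by move=> Pc Qd i ik; apply: coefO_convol ik _ _.
have AB := CM A B a b Aa Bb.
have E1 := CM _ _ _ _ AB (CJ _ _ AB) k (ltnSn k).
have E2 := CM _ _ _ _ (CM _ _ _ _ Aa (CJ _ _ Aa)) (CM _ _ _ _ Bb (CJ _ _ Bb)) k (ltnSn k).
exact: etrans (etrans (esym E1) (congr1 (coefO k) (gnormM A B))) E2.
Qed.

End NormalMultiplicative.

(** * Convergence of power series *)

Section GeometricBounds.
Variable R : realType.
Implicit Types (x r : R).

Lemma geometric_sum_le x n : 0 <= x -> x < 1 ->
  \sum_(i < n) x ^+ i <= (1 - x)^-1.
Proof.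
move=> x0 x1; rewrite -[leRHS]div1r ler_pdivlMr ?subr_gt0 //.
by have := subrX1 x n; have := exprn_ge0 n x0; lra.
Qed.

(** [x ^+ n] is the smallest of the n + 1 powers in the geometric sum. The bound absorbs the number
    of terms of a convolution and the linear factor in [delta_inv_le]. *)
Lemma natmul_expr_le x n : 0 <= x -> x < 1 -> n.+1%:R * x ^+ n <= (1 - x)^-1.
Proof.
move=> x0 x1; apply: le_trans (geometric_sum_le n.+1 x0 x1).
rewrite mulr_natl -[X in _ *+ X]card_ord -sumr_const.
by apply: ler_sum => -[i] /= ik _; rewrite ler_wiXn2l // ltW.
Qed.

Lemma radius_between (rho : \bar R) r : (r%:E < rho)%E ->
  exists2 r', r < r' & (r'%:E < rho)%E.
Proof.
case: rho => [s| |] //; last by exists (r + 1); rewrite ?ltrDl ?ltr01 ?ltry.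
by rewrite lte_fin => rs; exists ((r + s) / 2); rewrite ?lte_fin; lra.
Qed.

End GeometricBounds.

Section Summability.
Variable R : realType.

(** Completeness in the form needed for power series, stated as a property of the space because it
    passes to products and so reaches R^8 in three doublings. *)
Definition summable_cvg (V : normedModType R) := forall u : nat -> V,
  (exists M, forall n, \sum_(i < n) `|u i| <= M) ->
  exists l : V, series u @ \oo --> l.

Lemma summable_cvg_real : summable_cvg R.
Proof.
move=> u [M uM]; exists (limn (series u)); apply: normed_cvg.
apply: nondecreasing_is_cvgn.
  by apply: nondecreasing_series => n _ _; exact: normr_ge0.
by exists M => _ [n _ <-]; have := uM n; rewrite -(big_mkord xpredT (fun i => `|u i|)).
Qed.

Lemma summable_cvg_pair (V W : normedModType R) :
  summable_cvg V -> summable_cvg W -> summable_cvg (V * W)%type.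
Proof.
move=> hV hW u [M uM].
have [|l1 s1] := hV (fst \o u).
  exists M => n; apply: le_trans (uM n); apply: ler_sum => i _.
  by rewrite prod_normE le_max lexx.
have [|l2 s2] := hW (snd \o u).
  exists M => n; apply: le_trans (uM n); apply: ler_sum => i _.
  by rewrite prod_normE le_max lexx orbT.
exists (l1, l2).
have -> : series u = fun n => (series (fst \o u) n, series (snd \o u) n).
  apply/funext => n; rewrite /series /=.
  elim: n => [|n IH]; first by rewrite !big_geq.
  by rewrite !big_nat_recr //= IH.
by apply: cvg_pair; [exact: s1 | exact: s2].
Qed.

Lemma summable_cvg_octonion : summable_cvg (octonion R).
Proof.
have h1 := summable_cvg_pair summable_cvg_real summable_cvg_real.
have h2 := summable_cvg_pair h1 h1.
exact: (summable_cvg_pair h2 h2).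
Qed.

End Summability.

(** * Growth of coefficient sequences *)

Section ConvergingSequences.
Variables (R : realType) (rho : \bar R).

(* The sequence of coefficients of a power series converging in [oct_ball rho]. *)
Definition radial (V : normedModType R) (a : nat -> V) := forall r : R,
  0 <= r -> (r%:E < rho)%E -> exists M, forall i, r ^+ i * `|a i| <= M.

Section Normed.
Variable V : normedModType R.
Implicit Types a b : nat -> V.

Lemma radial_bound a r : radial a -> 0 <= r -> (r%:E < rho)%E ->
  exists2 M, 0 <= M & forall i, r ^+ i * `|a i| <= M.
Proof.
move=> ca r0 rr; have [M aM] := ca r r0 rr; exists M => //.
by apply: le_trans (aM 0%N); rewrite mulr_ge0.
Qed.

(** The terms are bounded at a slightly larger radius [r'], so at [r] they are dominated by a
    geometric series of ratio [r / r']. *)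
Lemma radial_summable a r : radial a -> 0 <= r -> (r%:E < rho)%E ->
  exists2 M, 0 <= M & forall n, \sum_(i < n) r ^+ i * `|a i| <= M.
Proof.
move=> ca r0 rr; have [r' rr' r'r] := radius_between rr.
have r'0 : 0 < r' by exact: le_lt_trans rr'.
have [M M0 aM] := radial_bound ca (ltW r'0) r'r.
have x0 : 0 <= r / r' by rewrite divr_ge0 // ltW.
have x1 : r / r' < 1 by rewrite ltr_pdivrMr ?mul1r.
exists (M * (1 - r / r')^-1); first by rewrite mulr_ge0 // invr_ge0 subr_ge0 ltW.
move=> n; apply: (@le_trans _ _ (\sum_(i < n) M * (r / r') ^+ i)); last first.
  by rewrite -mulr_sumr ler_wpM2l // geometric_sum_le.
apply: ler_sum => i _.
have -> : r ^+ i = (r / r') ^+ i * r' ^+ i by rewrite expr_div_n divfK ?expf_neq0 ?gt_eqF.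
by rewrite -mulrA mulrC ler_wpM2r ?exprn_ge0.
Qed.

Lemma radialD a b : radial a -> radial b -> radial (a + b).
Proof.
move=> ca cb r r0 rr; have [M aM] := ca r r0 rr; have [N bN] := cb r r0 rr.
exists (M + N) => i; apply: le_trans (lerD (aM i) (bN i)).
by rewrite -mulrDr ler_wpM2l ?exprn_ge0 // ler_normD.
Qed.

Lemma radialZ c a : radial a -> radial (c *: a).
Proof.
move=> ca r r0 rr; have [M aM] := ca r r0 rr; exists (`|c| * M) => i.
by rewrite sseqZ normrZ mulrCA ler_wpM2l.
Qed.

Lemma radialN a : radial a -> radial (- a).
Proof. by move=> ca; rewrite -scaleN1r; exact: radialZ. Qed.

Lemma radialB a b : radial a -> radial b -> radial (a - b).
Proof. by move=> ca cb; apply: radialD => //; exact: radialN. Qed.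

Lemma radial_shift a : radial a -> radial (sshift a).
Proof.
move=> ca r r0 rr; have [M M0 aM] := radial_bound ca r0 rr; exists (r * M).
case=> [|i] /=; first by rewrite normr0 mulr0 mulr_ge0.
by rewrite exprS -mulrA ler_wpM2l.
Qed.

Lemma radial_quad A B C a : radial a -> radial (quadmul A B C a).
Proof.
by move=> ca; apply: radialD; first apply: radialD; apply: radialZ;
  do ?apply: radial_shift.
Qed.

Lemma radial_iter_quad A B C a n : radial a -> radial (iter n (quadmul A B C) a).
Proof. by move=> ca; elim: n => //= n IH; exact: radial_quad. Qed.

End Normed.

Lemma radial_bounded_map (V W : normedModType R) (phi : V -> W) (c : R) a :
  (forall v, `|phi v| <= c * `|v|) -> radial a -> radial (phi \o a).
Proof.
move=> phic ca r r0 rr; have [M M0 aM] := radial_bound ca r0 rr.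
exists (`|c| * M) => i /=; apply: (@le_trans _ _ (r ^+ i * (`|c| * `|a i|))).
  rewrite ler_wpM2l ?exprn_ge0 //; apply: le_trans (phic _) _.
  by rewrite ler_wpM2r // ler_norm.
by rewrite mulrCA ler_wpM2l.
Qed.

Local Notation O := (octonion R).

(** The octonionic norm is multiplicative, the sup norm is not; 9 is the square of the constant 3
    that compares them. *)
Lemma oct_norm_sup_mul (x y : O) : `|x ** y| <= 9 * (`|x| * `|y|).
Proof.
apply: le_trans (oct_norm_sup _) _; rewrite oct_normM.
apply: le_trans (ler_pM (oct_norm_ge0 _) (oct_norm_ge0 _)
  (oct_norm_le_sup x) (oct_norm_le_sup y)) _.
by rewrite mulrACA; apply: ler_wpM2r; rewrite ?mulr_ge0 //; lra.
Qed.

Lemma radial_const (u : O) : radial (sconst u).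
Proof.
move=> r r0 rr; exists `|u| => -[|i] /=; first by rewrite mul1r.
by rewrite normr0 mulr0.
Qed.

Lemma radial_affine (u v : O) : radial (saffine u v).
Proof. by apply: radialD; [|apply: radial_shift]; exact: radial_const. Qed.

Lemma radial_conj (a : nat -> O) : radial a -> radial (sconj a).
Proof.
apply: (@radial_bounded_map _ _ _ 3) => v; apply: le_trans (oct_norm_sup _) _.
by rewrite oct_norm_conj oct_norm_le_sup.
Qed.

(** At a radius r' > r each of the k + 1 summands of the coefficient [k] is bounded by [C]; the loss
    k + 1 is compensated by the decay of [(r / r') ^+ k]. *)
Lemma radial_convol (a b : nat -> O) : radial a -> radial b -> radial (convol a b).
Proof.
move=> ca cb r r0 rr; have [r' rr' r'r] := radius_between rr.
have r'0 : 0 < r' by exact: le_lt_trans rr'.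
have [M M0 aM] := radial_bound ca (ltW r'0) r'r.
have [N N0 bN] := radial_bound cb (ltW r'0) r'r.
have x0 : 0 <= r / r' by rewrite divr_ge0 // ltW.
have x1 : r / r' < 1 by rewrite ltr_pdivrMr ?mul1r.
pose C := 9 * (M * N); have C0 : 0 <= C by rewrite mulr_ge0 // mulr_ge0.
exists (C * (1 - r / r')^-1) => k.
apply: le_trans (_ : (r / r') ^+ k * (k.+1%:R * C) <= _); last first.
  have -> : (r / r') ^+ k * (k.+1%:R * C) = C * (k.+1%:R * (r / r') ^+ k) by ring.
  by rewrite ler_wpM2l // natmul_expr_le.
rewrite expr_div_n -mulrA ler_wpM2l ?exprn_ge0 // ler_pdivlMl ?exprn_gt0 //.
apply: (@le_trans _ _ (\sum_(i < k.+1) C)); last first.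
  by rewrite sumr_const card_ord mulr_natl.
apply: le_trans (_ : \sum_(i < k.+1) r' ^+ k * `|a i ** b (k - i)%N| <= _).
  by rewrite -mulr_sumr ler_wpM2l ?exprn_ge0 ?(ltW r'0) // ler_norm_sum.
apply: ler_sum => -[i ik] _ /=.
apply: (@le_trans _ _ (9 * ((r' ^+ i * `|a i|) * (r' ^+ (k - i) * `|b (k - i)%N|)))).
  have -> : r' ^+ k = r' ^+ i * r' ^+ (k - i) by rewrite -exprD subnKC // -ltnS.
  have -> : forall p q y z : R, 9 * (p * y * (q * z)) = p * q * (9 * (y * z)).
    by move=> *; ring.
  by rewrite ler_wpM2l ?oct_norm_sup_mul // mulr_ge0 // exprn_ge0 // ltW.
by rewrite ler_pM2l // ler_pM ?mulr_ge0 ?exprn_ge0 ?(ltW r'0).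
Qed.

Lemma radial_normal (a : nat -> O) : radial a -> radial (snormal a).
Proof. by move=> ca; apply: radial_convol => //; exact: radial_conj. Qed.

End ConvergingSequences.

(** * Expansions and the uniqueness of coefficients *)

Section Expansions.
Variables (R : realType) (rho : \bar R).
Local Notation O := (octonion R).
Implicit Types (f g : O -> O) (a b : nat -> O) (w : O).

Lemma oct_series_real a r : oct_series a r%:O = series (fun i => r ^+ i *: a i).
Proof.
by congr series; apply/funext => i; rewrite oct_pow_real oct_mul_reall.
Qed.

Lemma oct_ball_real r : 0 <= r -> (r%:E < rho)%E -> oct_ball rho (r%:O : O).
Proof. by move=> r0 rr; rewrite /oct_ball /= oct_norm_real ger0_norm. Qed.

(** Convergence at the real points of the ball suffices: there the terms are [r ^+ i *: a i], they
    tend to 0 and so are bounded. *)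
Lemma expansion_radial f a : expansion rho f a -> radial rho a.
Proof.
move=> ea r r0 rr; have := ea _ (oct_ball_real r0 rr).
rewrite oct_series_real => /cvgP/cvg_series_cvg_0/cvgP/cvg_seq_bounded.
move=> [M [_ HM]]; exists (M + 1) => i.
have := HM (M + 1); rewrite ltrDl ltr01 => /(_ isT i I) /=.
by rewrite normrZ ger0_norm ?exprn_ge0.
Qed.

Lemma radial_term a w : radial rho a -> oct_ball rho w ->
  exists M, forall n, \sum_(i < n) `|oct_pow w i ** a i| <= M.
Proof.
move=> ca bw; have [M M0 HM] := radial_summable ca (oct_norm_ge0 w) bw.
exists (3 * M) => n; apply: le_trans (_ : \sum_(i < n) 3 * (oct_norm w ^+ i * `|a i|) <= _).
  apply: ler_sum => i _; apply: le_trans (oct_norm_sup _) _.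
  rewrite oct_normM oct_norm_pow mulrCA ler_wpM2l ?exprn_ge0 ?oct_norm_ge0 //.
  exact: oct_norm_le_sup.
by rewrite -mulr_sumr ler_wpM2l.
Qed.

Lemma radial_expansion a : radial rho a -> expansion rho (psum a) a.
Proof.
move=> ca w bw; have [|l cl] := @summable_cvg_octonion R (fun i => oct_pow w i ** a i).
  exact: radial_term.
by rewrite /psum (cvg_lim (@norm_hausdorff _ _) cl).
Qed.

Lemma expansion_psum f a w : expansion rho f a -> oct_ball rho w -> f w = psum a w.
Proof.
by move=> ea bw; rewrite /psum (cvg_lim (@norm_hausdorff _ _) (ea w bw)).
Qed.

(** Identity theorem along the nonnegative real axis: if the coefficients below [m] vanish, the
    terms after index [m] contribute only the order r^(m + 1), and small [r] forces [a m = 0]. *)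
Lemma radial_zero a : (0 < rho)%E -> radial rho a ->
  (forall r, 0 <= r -> (r%:E < rho)%E ->
     series (fun i => r ^+ i *: a i) @ \oo --> (0 : O)) ->
  a = 0.
Proof.
move=> rho0 ca a0; apply/funext => m; elim/ltn_ind: m => m IH.
have [r0 r00 r0r] := radius_between rho0.
have [M M0 HM] := radial_summable ca (ltW r00) r0r.
have key r : 0 < r -> r <= r0 -> r ^+ m * `|a m| <= (r / r0) ^+ m.+1 * M.
  move=> rp rr0.
  have rr : (r%:E < rho)%E by apply: le_lt_trans r0r; rewrite lee_fin.
  have x0 : 0 <= r / r0 by rewrite divr_ge0 // ltW.
  have x1 : r / r0 <= 1 by rewrite ler_pdivrMr ?mul1r.
  rewrite -[leRHS]addr0 -subr_ge0.
  (* The partial sums tend to 0, so adding their norm to the right-hand side costs nothing in the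
     limit. *)
  have /cvg_norm := a0 r (ltW rp) rr; rewrite normr0 => cn.
  have cn' : (fun n => (r / r0) ^+ m.+1 * M + `|series (fun i => r ^+ i *: a i) n|)
      @ \oo --> (r / r0) ^+ m.+1 * M + 0.
    by apply: cvgD => //; exact: cvg_cst.
  rewrite subr_ge0 -(cvg_lim (@Rhausdorff R) cn'); apply: limr_ge; first exact: cvgP cn'.
  exists m.+1 => // N /= mN; rewrite [series _ _]big_mkord.
  rewrite (bigD1 (Ordinal mN)) //= -[leLHS](_ : `|r ^+ m *: a m| = _); last first.
    by rewrite normrZ ger0_norm // exprn_ge0 // ltW.
  rewrite [leRHS]addrC.
  apply: le_trans (_ : `|r ^+ m *: a m + \sum_(i < N | i != Ordinal mN) r ^+ i *: a i| +
     `|\sum_(i < N | i != Ordinal mN) r ^+ i *: a i| <= _).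
    by rewrite -[X in `|X| <= _](addrK (\sum_(i < N | i != Ordinal mN) r ^+ i *: a i)) ler_normB.
  rewrite lerD2l; apply: le_trans (ler_norm_sum _ _ _) _.
  apply: le_trans (_ : \sum_(i < N) (r / r0) ^+ m.+1 * (r0 ^+ i * `|a i|) <= _); last first.
    by rewrite -mulr_sumr ler_wpM2l ?exprn_ge0.
  rewrite [leRHS](bigD1 (Ordinal mN)) //= ler_wpDl //.
    by rewrite !mulr_ge0 // exprn_ge0 // ltW.
  apply: ler_sum => i; rewrite -val_eqE /= => im.
  have [im'|mi] := ltnP i m.
    by rewrite (IH i im') scaler0 !normr0 !mulr0.
  have {im} mi : (m < i)%N by rewrite ltn_neqAle eq_sym im.
  rewrite normrZ ger0_norm ?exprn_ge0 ?(ltW rp) //.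
  have -> : r ^+ i = (r / r0) ^+ i * r0 ^+ i by rewrite expr_div_n divfK ?expf_neq0 ?gt_eqF.
  by rewrite -mulrA ler_wpM2r ?mulr_ge0 ?exprn_ge0 ?(ltW r00) // ler_wiXn2l.
apply/eqP; rewrite -normr_le0; apply/ler_addgt0Pl => e e0.
(* After division by [r ^+ m], [key] bounds the norm of [a m] by [r * K]. The radius chosen next
   makes this at most [e]; the denominator K + 1 keeps it positive also when [K] is 0. *)
pose K := M / r0 ^+ m.+1.
have K0 : 0 <= K by rewrite divr_ge0 // exprn_ge0 // ltW.
pose r := Num.min r0 (e / (K + 1)).
have rp : 0 < r by rewrite lt_min r00 divr_gt0 // ltr_wpDl.
have := key r rp; rewrite ge_min lexx => /(_ isT).
have -> : (r / r0) ^+ m.+1 * M = r ^+ m * (r * K).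
  by rewrite expr_div_n /K exprSr mulrA mulrA mulrAC.
rewrite ler_pM2l ?exprn_gt0 // addr0 => /le_trans; apply.
have : r <= e / (K + 1) by rewrite ge_min lexx orbT.
rewrite ler_pdivlMr ?ltr_wpDl // => H; apply: le_trans H.
by rewrite ler_wpM2l ?lerDl // ltW.
Qed.

Lemma expansion_unique f a b : (0 < rho)%E ->
  expansion rho f a -> expansion rho f b -> a = b.
Proof.
move=> rho0 ea eb; suff E : a - b = 0.
  by apply/funext => k; have := congr1 (fun h => h k) E; exact: subr0_eq.
have ra := expansion_radial ea; have rb := expansion_radial eb.
refine (radial_zero rho0 (radialB ra rb) _) => r r0 rr.
have bw := oct_ball_real r0 rr.
have H := cvgB (ea _ bw) (eb _ bw); rewrite subrr !oct_series_real in H.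
have -> : series (fun i => r ^+ i *: (a - b) i) =
    series (fun i => r ^+ i *: a i) - series (fun i => r ^+ i *: b i).
  apply/funext => n; rewrite /series /= sseqD sseqN -sumrB; apply: eq_bigr => i _.
  by rewrite sseqD sseqN scalerBr.
exact: H.
Qed.

End Expansions.

(** * Finiteness of multiplicities *)

Section Blaschke.
Variable R : realType.
Implicit Types (x y : nat -> R).

Let scale_mulE (a b : R) : a *: b = a * b. Proof. by []. Qed.

Definition sqsum_le (L : R) y := forall n, \sum_(k < n) y k ^+ 2 <= L.

Lemma cvg0_sshift y : y @ \oo --> (0 : R) -> sshift y @ \oo --> (0 : R).
Proof. by move=> y0; rewrite -(cvg_shiftS (sshift y)). Qed.

Lemma cvg0_quadmul A B C y :
  y @ \oo --> (0 : R) -> quadmul A B C y @ \oo --> (0 : R).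
Proof.
move=> y0; have y1 := cvg0_sshift y0; have y2 := cvg0_sshift y1.
have Z c (z : nat -> R) : z @ \oo --> (0 : R) -> (c *: z) @ \oo --> (0 : R).
  move=> z0; have : (fun k => c * z k) @ \oo --> c * 0 by apply: cvgM => //; exact: cvg_cst.
  by rewrite mulr0.
rewrite -[0](addr0 0) -[X in X + 0](addr0 0).
by apply: cvgD; [apply: cvgD|]; apply: Z.
Qed.

(* The difference of the two squared norms telescopes, with a remainder that is
   quadratic in the last terms of [y]: this is the isometry property of the
   Blaschke factor [(A w^2 + B w + C) / (C w^2 + B w + A)]. *)
Lemma sqsum_quadmul_rev L A B C y : y @ \oo --> (0 : R) ->
  sqsum_le L (quadmul A B C y) -> sqsum_le L (quadmul C B A y).
Proof.
move=> y0 yL n.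
pose E k := (C ^+ 2 - A ^+ 2) * (y k * y k + sshift y k * sshift y k)
            + 2 * B * (C - A) * (y k * sshift y k).
have tele N : \sum_(k < N.+1) quadmul A B C y k ^+ 2 =
              \sum_(k < N.+1) quadmul C B A y k ^+ 2 + E N.
  elim: N => [|N IH].
    rewrite !big_ord1 !quadmulE0 /E /= !mulr0 !addr0.
    by rewrite !scale_mulE; ring.
  rewrite big_ord_recr [in RHS]big_ord_recr /= IH /E /quadmul !sseqD !sseqZ /=.
  by move: (sshift y N) (y N) (y N.+1) => p q r;
    rewrite !scale_mulE; ring.
have y1 := cvg0_sshift y0.
have E0 : E @ \oo --> (0 : R).
  have M (u v : nat -> R) : u @ \oo --> (0 : R) -> v @ \oo --> (0 : R) ->
      (fun k => u k * v k) @ \oo --> (0 : R).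
    by move=> u0 v0; rewrite -[0](mulr0 0); exact: cvgM.
  rewrite (_ : 0 = (C ^+ 2 - A ^+ 2) * (0 + 0) + 2 * B * (C - A) * 0); last by ring.
  apply: cvgD; apply: cvgM; (try exact: cvg_cst); last exact: M.
  by apply: cvgD; apply: M.
(* At a finite stage the two sums differ by [E N], so the bound [L] for the reversed sequence is
   reached only in the limit; a fixed partial sum is dominated by all longer ones. *)
have LE : (fun k => L - E k) @ \oo --> L - 0 by apply: cvgB => //; exact: cvg_cst.
rewrite -[L]subr0 -(cvg_lim (@Rhausdorff R) LE); apply: limr_ge; first exact: cvgP LE.
exists n => // N /= nN; have := yL N.+1; rewrite tele -lerBrDr; apply: le_trans.
have nN1 : (n <= N.+1)%N by exact: leq_trans nN _.
rewrite (big_ord_widen _ (fun k => quadmul C B A y k ^+ 2) nN1) big_mkcond /=.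
by apply: ler_sum => i _; case: ifP => // _; exact: sqr_ge0.
Qed.

(** The outermost factor is reversed, commuted to the innermost place, and the induction continues
    with [quadmul C B A y] in place of [y]. *)
Lemma sqsum_iter_quadmul_rev L A B C s y : y @ \oo --> (0 : R) ->
  sqsum_le L (iter s (quadmul A B C) y) -> sqsum_le L (iter s (quadmul C B A) y).
Proof.
elim: s y => [//|s IH] y y0 yL.
have iter0 k z : z @ \oo --> (0 : R) -> iter k (quadmul A B C) z @ \oo --> (0 : R).
  by move=> z0; elim: k => //= k IHk; exact: cvg0_quadmul.
have := sqsum_quadmul_rev (iter0 s _ y0) yL.
have -> : quadmul C B A (iter s (quadmul A B C) y) =
    iter s (quadmul A B C) (quadmul C B A y).
  by elim: s {IH yL} => //= s IHs; rewrite [LHS]quadmulC IHs.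
by move/IH; rewrite -iterSr; apply; exact: cvg0_quadmul.
Qed.

Lemma quadmul_lead A B C m x : (forall i, (i < m)%N -> x i = 0) ->
  (forall i, (i < m)%N -> quadmul A B C x i = 0) /\ quadmul A B C x m = C * x m.
Proof.
move=> x0.
have x1 i : (i <= m)%N -> sshift x i = 0 by case: i => //= i; exact: x0.
have x2 i : (i <= m)%N -> sshift (sshift x) i = 0.
  by case: i => //= i im; apply: x1; exact: ltnW.
split=> [i im|]; rewrite /quadmul !sseqD !sseqZ ?x1 ?x2 ?scaler0 ?addr0 //.
- by rewrite x0 // scaler0.
- exact: ltnW.
- exact: ltnW.
Qed.

Lemma iter_quadmul_lead A B C m s x : (forall i, (i < m)%N -> x i = 0) ->
  (forall i, (i < m)%N -> iter s (quadmul A B C) x i = 0) /\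
  iter s (quadmul A B C) x m = C ^+ s * x m.
Proof.
move=> x0; elim: s => [|s [IH1 IH2]]; first by split=> //; rewrite mul1r.
have [H1 H2] := quadmul_lead A B C IH1.
by split=> //=; rewrite H2 IH2 mulrA -exprS.
Qed.

Lemma quadmul_vanish A B C m x : C != 0 ->
  (forall i, (i < m)%N -> quadmul A B C x i = 0) ->
  forall i, (i < m)%N -> x i = 0.
Proof.
move=> C0 Q0 i; elim/ltn_ind: i => i IH im.
have [|_ H] := @quadmul_lead A B C i x.
  by move=> j ji; apply: IH => //; exact: ltn_trans im.
move: H; rewrite Q0 // => /esym/eqP; rewrite mulf_eq0 (negPf C0) => /eqP //.
Qed.

(** The substitution of r w for w: the circle of radius [r] becomes the unit circle, where
    [sqsum_quadmul_rev] applies. *)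
Lemma quadmul_scale A B C (r : R) x :
  (fun k => r ^+ k * quadmul A B C x k) =
  quadmul (r ^+ 2 * A) (r * B) C (fun k => r ^+ k * x k).
Proof.
apply/funext => k; rewrite /quadmul !sseqD !sseqZ.
rewrite !scale_mulE.
by case: k => [|[|k]] /=; rewrite ?exprS; ring.
Qed.

Lemma iter_quadmul_scale A B C (r : R) s x :
  (fun k => r ^+ k * iter s (quadmul A B C) x k) =
  iter s (quadmul (r ^+ 2 * A) (r * B) C) (fun k => r ^+ k * x k).
Proof. by elim: s => //= s <-; rewrite quadmul_scale. Qed.

(** Reflection exchanges the outer coefficients of the scaled factor: its constant coefficient [n]
    becomes [r ^+ 2]. After [s] reflections the lowest coefficient of the scaled [q] has been
    multiplied by (r^2 / n)^s, while the bound [L] on the sum of squares has not changed. *)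
Lemma quadmul_divisible_zero (rho : \bar R) (t n r : R) (q : nat -> R) :
  0 < n -> n < r ^+ 2 -> 0 <= r -> (r%:E < rho)%E -> radial rho q ->
  (forall s, exists2 h, radial rho h & q = iter s (quadmul 1 t n) h) -> q = 0.
Proof.
move=> n0 nr r0 rr cq qdiv; apply/funext => m; elim/ltn_ind: m => m IH.
have rp : 0 < r.
  by rewrite lt_neqAle r0 andbT eq_sym; apply/eqP => E; move: nr; rewrite E expr0n /=; lra.
have [M1 M10 HM1] := radial_bound cq r0 rr.
have [M M0 HM] := radial_summable cq r0 rr.
(* The sum of the squares is at most a bound for the terms times a bound for their sum. *)
pose L := M1 * M.
have qL : sqsum_le L (fun k => r ^+ k * q k).
  move=> N; apply: le_trans (_ : \sum_(k < N) M1 * (r ^+ k * `|q k|) <= _).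
    apply: ler_sum => k _; rewrite -real_normK ?num_real // normrM ger0_norm ?exprn_ge0 //.
    by rewrite expr2 ler_wpM2r // mulr_ge0 // exprn_ge0.
  by rewrite -mulr_sumr ler_wpM2l.
pose z := (n / r ^+ 2) ^+ 2.
have z0 : 0 <= z by exact: sqr_ge0.
have nr1 : n / r ^+ 2 < 1 by rewrite ltr_pdivrMr ?mul1r // exprn_gt0.
have nr0 : 0 <= n / r ^+ 2 by rewrite divr_ge0 // ltW // exprn_gt0.
have z1 : z < 1 by rewrite expr_lt1.
have key s : (r ^+ m * q m) ^+ 2 <= L * z ^+ s.
  have [h ch qh] := qdiv s.
  have h0 : forall i, (i < m)%N -> h i = 0.
    have : forall i, (i < m)%N -> iter s (quadmul 1 t n) h i = 0 by rewrite -qh.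
    elim: s {qh} => //= s IHs H; apply: IHs.
    by apply: quadmul_vanish H; rewrite gt_eqF.
  pose x k := r ^+ k * h k.
  have x0 : x @ \oo --> (0 : R).
    have [N N0 HN] := radial_summable ch r0 rr.
    have [|l cl] := @summable_cvg_real R x.
      exists N => k; apply: le_trans (HN k); apply: ler_sum => i _.
      by rewrite normrM ger0_norm ?exprn_ge0.
    exact: (cvg_series_cvg_0 (cvgP _ cl)).
  have xm i : (i < m)%N -> x i = 0 by move=> im; rewrite /x h0 // mulr0.
  have := qL; rewrite qh iter_quadmul_scale -/x => /(sqsum_iter_quadmul_rev x0).
  move=> /(_ m.+1); rewrite big_ord_recr /= => xL.
  have {xL} : iter s (quadmul n (r * t) (r ^+ 2 * 1)) x m ^+ 2 <= L.
    by apply: le_trans xL; rewrite lerDr; apply: sumr_ge0 => *; exact: sqr_ge0.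
  have [_ ->] := iter_quadmul_lead n (r * t) (r ^+ 2 * 1) s xm.
  have [_ ->] := iter_quadmul_lead 1 t n s h0.
  rewrite mulr1 => H; rewrite [L * _]mulrC.
  have -> : (r ^+ m * (n ^+ s * h m)) ^+ 2 = z ^+ s * ((r ^+ 2) ^+ s * x m) ^+ 2.
    have -> : z ^+ s = ((n / r ^+ 2) ^+ s) ^+ 2 by rewrite -!exprM mulnC.
    rewrite -[RHS]exprMn; congr (_ ^+ 2).
    rewrite [in RHS]mulrA -exprMn divfK ?expf_neq0 ?gt_eqF // /x; ring.
  by rewrite ler_wpM2l // exprn_ge0.
have cz : (fun s => L * z ^+ s) @ \oo --> (0 : R).
  by apply: cvg_geometric; rewrite ger0_norm.
have : (r ^+ m * q m) ^+ 2 <= 0.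
  rewrite -(cvg_lim (@Rhausdorff R) cz); apply: limr_ge; first exact: cvgP cz.
  by exists 0%N.
rewrite real_exprn_even_le0 ?num_real //= mulf_eq0 expf_eq0 (gt_eqF rp) andbF /=.
by move/eqP.
Qed.

End Blaschke.

(** * Division by Delta and values on a conjugacy class *)

Lemma cvg_comb3 (R : realType) (V : normedModType R) (c d : R)
    (x y z : nat -> V) (lx ly lz : V) :
  x @ \oo --> lx -> y @ \oo --> ly -> z @ \oo --> lz ->
  (fun N => c *: x N + d *: y N + z N) @ \oo --> c *: lx + d *: ly + lz.
Proof.
move=> hx hy hz; apply: cvgD => //.
by apply: cvgD; apply: cvgZl_tmp.
Qed.

(* The power series expansion of [1 / (1 - t w + n w^2)]. *)
Fixpoint delta_inv (R : realType) (t n : R) (m : nat) : R :=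
  if m is m'.+1 then
    (if m' is m''.+1 then t * delta_inv t n m' - n * delta_inv t n m'' else t)
  else 1.

Lemma delta_invSS (R : realType) (t n : R) m :
  delta_inv t n m.+2 = t * delta_inv t n m.+1 - n * delta_inv t n m.
Proof. by []. Qed.

(** The coefficient of each [b j] with j > 0 is a three-term combination that the recurrence
    annihilates. The lengths N, N + 1 and N + 2 make all three sums stop at [b N.+1], so no boundary
    term is left. *)
Lemma delta_inv_telescope (R : realType) (V : lmodType R) (t n : R) (b : nat -> V) N :
  n *: (\sum_(0 <= m < N) delta_inv t n m *: b m.+2)
  + - t *: (\sum_(0 <= m < N.+1) delta_inv t n m *: b m.+1)
  + \sum_(0 <= m < N.+2) delta_inv t n m *: b m = b 0%N.
Proof.
elim: N => [|N IH].
  rewrite big_geq // big_nat1 big_nat_recr // big_nat1 /=.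
  by rewrite scaler0 add0r !scale1r scaleNr addrCA addNr addr0.
rewrite big_nat_recr // [X in _ + _ *: X + _]big_nat_recr // [X in _ + X = _]big_nat_recr //=.
rewrite -[RHS]IH !scalerDr.
move: (b _) (\sum_(0 <= _ < _) _) (\sum_(0 <= _ < _) _) (\sum_(0 <= _ < _) _) => e X Y Z.
rewrite [X in X + _ = _]addrACA [LHS]addrACA -[RHS]addr0; congr (_ + _).
rewrite -/(delta_inv t n N.+1) -/(delta_inv t n N.+2) !scalerA -!scalerDl.
rewrite delta_invSS; set c := _ + _.
by rewrite (_ : c = 0) ?scale0r // /c; ring.
Qed.

Section Division.
Variables (R : realType) (rho : \bar R).
Local Notation O := (octonion R).
Local Notation conj := (@oct_conj R).
Variable al : O.
Hypothesis ball_al : oct_ball rho al.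

Let t := oct_Re al *+ 2.
Let n := oct_nsqr al.

Local Notation u := (delta_inv t n).

(* [u m] is the sum of the [al^i (conj al)^j] with [i + j = m]. *)
Lemma delta_inv_conj m : (u m.+1)%:O - u m *: al = oct_pow (conj al) m.+1.
Proof.
elim: m => [|m IH].
  rewrite -[oct_pow _ _]/(conj al ** 1%:O) -[u 1%N]/t -[u 0%N]/(1 : R).
  rewrite oct_mul_realr !scale1r /t -oct_add_conj.
  by rewrite addrC addKr.
rewrite oct_powS -IH oct_mulBr oct_mul_realr oct_scaleAr oct_mul_conjl delta_invSS.
have -> : conj al = t%:O - al by rewrite /t -oct_add_conj addrC addKr.
rewrite scalerBr !oct_realZ oct_realD oct_realN mulrC [n * _]mulrC.
by rewrite addrAC.
Qed.

(** The closed form replaces the second-order recurrence by [u m.+1 = u m * al + (conj al)^(m + 1)],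
    whose norm gives the sharp rate |al|. Estimating the second-order recurrence term by term would
    give a larger rate. *)
Lemma delta_inv_le m : `|u m| <= m.+1%:R * oct_norm al ^+ m.
Proof.
elim: m => [|m IH]; first by rewrite /= normr1 mul1r.
apply: (@le_trans _ _ `|(u m.+1)%:O|); first by rewrite !prod_normE /= !le_max lexx.
rewrite -[(u m.+1)%:O](subrK (u m *: al)) delta_inv_conj.
apply: le_trans (ler_normD _ _) _; rewrite normrZ.
apply: le_trans (_ : oct_norm al ^+ m.+1 + m.+1%:R * oct_norm al ^+ m * oct_norm al <= _).
  apply: lerD; last by rewrite ler_pM // oct_norm_sup.
  by apply: le_trans (oct_norm_sup _) _; rewrite oct_norm_pow oct_norm_conj.
by rewrite -mulrA -exprSr -[m.+2%:R]natr1 mulrDl mul1r addrC.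
Qed.

Lemma delta_inv_summable r : oct_norm al < r ->
  exists2 C, 0 <= C & forall N, \sum_(m < N) `|u m| * r ^- m <= C.
Proof.
(* The midpoint splits the ratio |al| / r into two ratios below 1: one absorbs the linear factor,
   the other leaves a geometric series. *)
move=> alr; pose r1 := (oct_norm al + r) / 2.
have N0 := oct_norm_ge0 al.
have r10 : 0 < r1 by rewrite /r1; lra.
have r0 : 0 < r by exact: le_lt_trans alr.
have a1 : oct_norm al / r1 < 1 by rewrite ltr_pdivrMr // /r1; lra.
have a2 : r1 / r < 1 by rewrite ltr_pdivrMr // /r1; lra.
have p1 : 0 <= oct_norm al / r1 by rewrite divr_ge0 // ltW.
have p2 : 0 <= r1 / r by rewrite divr_ge0 // ltW.
have i1 : 0 <= (1 - oct_norm al / r1)^-1 by rewrite invr_ge0 subr_ge0 ltW.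
have i2 : 0 <= (1 - r1 / r)^-1 by rewrite invr_ge0 subr_ge0 ltW.
exists ((1 - oct_norm al / r1)^-1 * (1 - r1 / r)^-1); first exact: mulr_ge0.
move=> N; apply: le_trans (_ : \sum_(m < N) (1 - oct_norm al / r1)^-1 * (r1 / r) ^+ m <= _).
  apply: ler_sum => m _.
  apply: le_trans (_ : (m.+1%:R * (oct_norm al / r1) ^+ m) * (r1 / r) ^+ m <= _).
    rewrite -mulrA -exprMn mulrA divfK ?gt_eqF // expr_div_n mulrA.
    by rewrite ler_wpM2r ?delta_inv_le // invr_ge0 exprn_ge0 // ltW.
  by rewrite ler_wpM2r ?exprn_ge0 // natmul_expr_le.
by rewrite -mulr_sumr ler_wpM2l // geometric_sum_le.
Qed.

Variable a : nat -> O.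
Hypothesis ra : radial rho a.

Let tail_bound r : oct_norm al < r -> (r%:E < rho)%E ->
  exists2 C, 0 <= C & forall k N,
    r ^+ k * \sum_(m < N) `|u m *: a (k + m)%N| <= C.
Proof.
move=> alr rr; have [C C0 HC] := delta_inv_summable alr.
have r0 : 0 < r by apply: le_lt_trans alr; exact: oct_norm_ge0.
have [M M0 HM] := radial_bound ra (ltW r0) rr.
exists (C * M) => [|k N]; first exact: mulr_ge0.
rewrite mulr_sumr; apply: le_trans (_ : \sum_(m < N) (`|u m| * r ^- m) * M <= _).
  apply: ler_sum => m _; rewrite normrZ.
  have -> : r ^+ k * (`|u m| * `|a (k + m)%N|) =
      `|u m| * r ^- m * (r ^+ (k + m) * `|a (k + m)%N|).
    by rewrite exprD; field; rewrite expf_neq0 // gt_eqF.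
  by rewrite ler_wpM2l // mulr_ge0 // invr_ge0 exprn_ge0 // ltW.
by rewrite -mulr_suml ler_wpM2r.
Qed.

(** Iteration makes [tail k.+1 x m] convertible to [tail k x m.+1], so the series for consecutive
    quotient coefficients are shifts of one sequence by conversion. *)
Let tail (k : nat) (x : nat -> O) : nat -> O := iter k (fun y m => y m.+1) x.

Let tailE k x m : tail k x m = x (k + m)%N.
Proof. by elim: k m => //= k IH m; rewrite IH addnS. Qed.

(** Division by the expansion at infinity: 1 / Delta is the sum of the u_m w^(-m - 2), hence h_k
    must be the sum of the u_m a_(k + m + 2). It converges because |al| lies strictly inside the
    ball. The remainder is then read off the coefficients 0 and 1. *)
Lemma delta_division : exists h A B, radial rho h /\
  a = quadmul 1 (- t) n h + saffine A B.
Proof.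
have [r1 r1al r1rho] := radius_between ball_al.
have r10 : 0 < r1 by apply: le_lt_trans r1al; exact: oct_norm_ge0.
have ex k : exists l : O, series (fun m => u m *: tail k.+2 a m) @ \oo --> l.
  have [C C0 HC] := tail_bound r1al r1rho.
  apply: (@summable_cvg_octonion R (fun m => u m *: tail k.+2 a m)).
  exists (r1 ^- k.+2 * C) => N; rewrite ler_pdivlMl ?exprn_gt0 //.
  by under eq_bigr do rewrite tailE; exact: HC.
have [h Hh] := boolp.choice ex.
exists h, (a 1%N - quadmul 1 (- t) n h 1%N), (a 0%N - quadmul 1 (- t) n h 0%N).
split.
  move=> r r0 rr.
  (* The radius [r'] exceeds [r], where [h] is to be bounded, and [r1], so that the weights [u m]
     are summable against it. The factor [r' ^- 2] below comes from the index shift by 2. *)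
  have [r' r'm r'rho] : exists2 r', Num.max r r1 < r' & (r'%:E < rho)%E.
    by apply: radius_between; rewrite maxEle; case: ifP.
  move: r'm; rewrite gt_max => /andP[rr' r1r'].
  have r'0 : 0 < r' by exact: lt_trans r1r'.
  have [C C0 HC] := tail_bound (lt_trans r1al r1r') r'rho.
  exists (r' ^- 2 * C) => k.
  apply: le_trans (_ : r' ^+ k * `|h k| <= _).
    by rewrite ler_wpM2r // lerXn2r ?nnegrE ?(ltW r'0) // ltW.
  rewrite ler_pdivlMl ?exprn_gt0 // mulrA -exprD add2n mulrC -ler_pdivlMr ?exprn_gt0 //.
  have /cvg_norm cn := Hh k.
  rewrite -(cvg_lim (@Rhausdorff R) cn); apply: limr_le; first exact: cvgP cn.
  exists 0%N => // N _ /=; rewrite ler_pdivlMr ?exprn_gt0 // mulrC.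
  apply: le_trans (HC k.+2 N); rewrite ler_wpM2l ?exprn_ge0 ?(ltW r'0) //.
  have -> : series (fun m => u m *: tail k.+2 a m) N = \sum_(m < N) u m *: a (k.+2 + m)%N.
    by rewrite [LHS]big_mkord; apply: eq_bigr => m _; rewrite tailE.
  exact: ler_norm_sum.
apply/funext => -[|[|k]]; rewrite sseqD saffineE; [by rewrite addrC subrK..|].
rewrite addr0 /quadmul !sseqD !sseqZ /= scale1r.
have S0 := Hh k.+2; have S1 := Hh k.+1; have S2 := Hh k.
(* The partial sums are shifted to N, N + 1 and N + 2 terms, the lengths required by
   [delta_inv_telescope]. *)
rewrite -(cvg_shiftS (series _)) in S1.
rewrite -(cvg_shiftS (series _)) -(cvg_shiftS (fun N => series _ N.+1)) in S2.
pose b := tail k.+2 a.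
have S : (fun N => n *: (\sum_(0 <= m < N) u m *: b m.+2)
    + - t *: (\sum_(0 <= m < N.+1) u m *: b m.+1)
    + \sum_(0 <= m < N.+2) u m *: b m) @ \oo
    --> n *: h k.+2 + - t *: h k.+1 + h k.
  exact: cvg_comb3 S0 S1 S2.
have b0 : b 0%N = a k.+2 by rewrite /b tailE addn0.
rewrite (funext (fun N => etrans (@delta_inv_telescope R O t n b N) b0)) in S.
by apply: (cvg_unique (@norm_hausdorff _ _) _ S); exact: cvg_cst.
Qed.

End Division.

(** * Evaluating a series at a point of the class *)

Section Evaluation.
Variables (R : realType) (rho : \bar R).
Local Notation O := (octonion R).
Implicit Types (f g : O -> O) (a b : nat -> O) (w A B : O).

Lemma radial_term_cvg0 a w : radial rho a -> oct_ball rho w ->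
  (fun k => oct_pow w k ** a k) @ \oo --> (0 : O).
Proof.
move=> ra bw; have := radial_expansion ra bw.
by move=> /cvgP/cvg_series_cvg_0.
Qed.

Lemma expansionD f g a b : expansion rho f a -> expansion rho g b ->
  expansion rho (fun w => f w + g w) (a + b).
Proof.
move=> ea eb w bw; have := cvgD (ea w bw) (eb w bw).
have -> : oct_series (a + b) w = oct_series a w + oct_series b w.
  apply/funext => N; rewrite sseqD /oct_series /series /= -big_split /=.
  by apply: eq_bigr => i _; rewrite sseqD oct_mulDr.
exact.
Qed.

Lemma expansion_finite f a n : (forall k, a (n + k)%N = 0) ->
  (forall w, f w = \sum_(i < n) oct_pow w i ** a i) -> expansion rho f a.
Proof.
move=> an fE w _; rewrite fE -(cvg_shiftn n).
rewrite (_ : (fun k => _) = fun=> \sum_(i < n) oct_pow w i ** a i); first exact: cvg_cst.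
apply/funext => k; rewrite /oct_series addnC; elim: k => [|k IH].
  by rewrite addn0 [LHS]big_mkord.
by rewrite addnS -[RHS]IH [LHS]big_nat_recr //= an oct_mul0r addr0.
Qed.

Lemma oct_pow0 w : oct_pow w 0 = 1%:O. Proof. by []. Qed.

Lemma oct_pow1 w : oct_pow w 1 = w.
Proof. by rewrite oct_powS oct_pow0 oct_mul_realr scale1r. Qed.

Lemma oct_mul1l w : 1%:O ** w = w. Proof. by rewrite oct_mul_reall scale1r. Qed.
Lemma oct_mul1r w : w ** 1%:O = w. Proof. by rewrite oct_mul_realr scale1r. Qed.

Lemma expansion_affine A B : expansion rho (fun w => w ** A + B) (saffine A B).
Proof.
apply: (@expansion_finite _ _ 2) => [[|k]|w]; rewrite ?saffineE //.
by rewrite !big_ord_recl big_ord0 oct_pow0 oct_pow1 !saffineE /= oct_mul1l addr0 addrC.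
Qed.

Lemma oct_powSS (t n : R) w k : w ** w = t *: w - n%:O ->
  oct_pow w k.+2 = t *: oct_pow w k.+1 - n *: oct_pow w k.
Proof.
by move=> ww; rewrite !oct_powS oct_altl ww oct_mulBl oct_scaleAl oct_mul_reall.
Qed.

Let mul_comb (c d : R) w x y z :
  w ** (c *: x - d *: y + z) = c *: (w ** x) - d *: (w ** y) + w ** z.
Proof. by rewrite oct_mulDr oct_mulBr !oct_scaleAr. Qed.

Let comb_mul (c d : R) w x y :
  (c *: x - d *: y) ** w = c *: (x ** w) - d *: (y ** w).
Proof. by rewrite oct_mulBl !oct_scaleAl. Qed.

Let comb_step (V : lmodType R) (n t : R) (c x1 x2 x3 x4 : V) :
  n *: x1 + - 1 *: x2 + c + (n *: x3 - t *: x4 + x2) =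
  n *: x3 + - 1 *: (t *: x4 - n *: x1) + c.
Proof.
rewrite !scaleN1r opprB; move: (n *: x1) (n *: x3) (t *: x4) => y1 y3 y4.
rewrite addrAC; congr (_ + _).
by rewrite [_ + x2]addrC addrA subrK addrCA.
Qed.

Let comb_init (V : lmodType R) (n t : R) (b x1 x2 x3 x4 : V) :
  n *: x1 + b + (n *: x2 - t *: x3 + x4) =
  n *: x2 + - 1 *: (t *: x3 - n *: x1) + (x4 + b).
Proof.
rewrite !scaleN1r opprB; move: (n *: x1) (n *: x2) (t *: x3) => z1 z2 z3.
rewrite [z1 + b]addrC -addrA [x4 + b]addrC [RHS]addrCA; congr (_ + _).
by rewrite -addrA addrCA -!addrA; congr (_ + _); rewrite addrCA.
Qed.

(** The factor Delta cannot simply be set to 0 at [w], evaluation not being multiplicative. Instead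
    the recurrence for the powers of [w] collapses the partial sums of Delta h to two boundary
    terms, which tend to 0. *)
Lemma expansion_sphere f h A B w (t n : R) :
  radial rho h -> oct_ball rho w -> w ** w = t *: w - n%:O ->
  expansion rho f (quadmul 1 (- t) n h + saffine A B) -> f w = w ** A + B.
Proof.
move=> rh bw ww ef; set c := _ + B.
pose x := quadmul 1 (- t) n h + saffine A B.
pose p := oct_pow w.
have pE k : p k.+2 = t *: p k.+1 - n *: p k by exact: oct_powSS.
have [p0 p1] : p 0%N = 1%:O /\ p 1%N = w by rewrite /p oct_pow0 oct_pow1.
have x0 : x 0%N = n *: h 0%N + B by rewrite /x sseqD quadmulE0 saffineE.
have xE k : x k.+1 = n *: h k.+1 - t *: h k + sshift h k + saffine A B k.+1.
  by rewrite /x /quadmul !sseqD !sseqZ /= scale1r scaleNr.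
have part N : \sum_(i < N.+2) p i ** x i =
    n *: (p N.+1 ** h N.+1) + - 1 *: (p N.+2 ** h N) + c.
  move: (p) pE p0 p1 (x) x0 xE => q qE q0 q1 y y0 yE.
  elim: N => [|N IH].
    rewrite !big_ord_recl big_ord0 addr0 /= /bump /= y0 yE saffineE qE q0 q1.
    by rewrite oct_mul1l /= addr0 /c mul_comb comb_mul oct_mul1l comb_init.
  rewrite big_ord_recr /= IH yE saffineE addr0 /= [q N.+3]qE.
  by rewrite mul_comb comb_mul comb_step.
have S : (fun N => n *: (p N.+1 ** h N.+1) + - 1 *: (p N.+2 ** h N) + c) @ \oo
    --> n *: (0 : O) + - 1 *: (0 : O) + c.
  apply: cvg_comb3; last exact: cvg_cst.
    by rewrite (cvg_shiftS (fun N => p N ** h N)); exact: radial_term_cvg0.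
  (* The product of [p N.+2] and [h N] is a term of the series with coefficients shifted twice. *)
  have := radial_term_cvg0 (radial_shift (radial_shift rh)) bw.
  by rewrite -cvg_shiftS -cvg_shiftS.
have S' := ef w bw; rewrite -cvg_shiftS -cvg_shiftS in S'.
have part' N : oct_series x w N.+2 =
    n *: (p N.+1 ** h N.+1) + - 1 *: (p N.+2 ** h N) + c.
  by rewrite -part [LHS]big_mkord.
rewrite (funext part') in S'.
have E0 : n *: (0 : O) + - 1 *: (0 : O) + c = c by rewrite !scaler0 !add0r.
rewrite E0 in S.
exact: (cvg_unique (@norm_hausdorff _ _) S' S).
Qed.

End Evaluation.

(** * Regular functions and their coefficients *)

Section RegularFunctions.
Variables (R : realType) (rho : \bar R).
Hypothesis rho0 : (0 < rho)%E.
Local Notation O := (octonion R).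
Implicit Types (f g q h : O -> O) (x y : nat -> O) (al w a b : O).
Local Notation coef := (coef rho).

Lemma expansion_coef f x : expansion rho f x -> coef f = x.
Proof.
move=> ef; apply: (expansion_unique rho0 _ ef).
exact: (@xgetPex _ (fun=> 0) [set a | expansion rho f a] (ex_intro _ x ef)).
Qed.

Lemma regular_coef f : regular rho f -> expansion rho f (coef f).
Proof. by move=> [x ef]; rewrite (expansion_coef ef). Qed.

Lemma regular_radial f : regular rho f -> radial rho (coef f).
Proof. by move=> /regular_coef/expansion_radial. Qed.

Lemma coef_psum x : radial rho x -> coef (psum x) = x.
Proof. by move=> /radial_expansion/expansion_coef. Qed.

Lemma regular_psum x : radial rho x -> regular rho (psum x).
Proof. by move=> /radial_expansion rx; exists x. Qed.

Lemma coef_star f g : regular rho f -> regular rho g ->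
  coef (star rho f g) = convol (coef f) (coef g).
Proof.
by move=> /regular_radial rf /regular_radial rg; apply: coef_psum; exact: radial_convol.
Qed.

Lemma regular_star f g : regular rho f -> regular rho g -> regular rho (star rho f g).
Proof.
by move=> /regular_radial rf /regular_radial rg; apply: regular_psum; exact: radial_convol.
Qed.

Lemma coef_conj_fun f : regular rho f -> coef (conj_fun rho f) = sconj (coef f).
Proof. by move=> /regular_radial rf; apply: coef_psum; exact: radial_conj. Qed.

Lemma regular_conj_fun f : regular rho f -> regular rho (conj_fun rho f).
Proof. by move=> /regular_radial rf; apply: regular_psum; exact: radial_conj. Qed.

Lemma regular_normal f : regular rho f -> regular rho (Defs.normal_fun rho f).
Proof. by move=> rf; exact: (regular_star rf (regular_conj_fun rf)). Qed.

Lemma coef_normal f : regular rho f -> coef (Defs.normal_fun rho f) = snormal (coef f).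
Proof.
move=> rf; rewrite /Defs.normal_fun (coef_star rf (regular_conj_fun rf)).
by rewrite (coef_conj_fun rf).
Qed.

Lemma eq_on_ballP f g : regular rho f -> regular rho g ->
  eq_on_ball rho f g <-> coef f = coef g.
Proof.
move=> rf rg; rewrite /eq_on_ball; split.
  move=> fg; apply: expansion_coef => w bw; rewrite (fg w bw).
  exact: (regular_coef rg bw).
move=> E w bw; rewrite (expansion_psum (regular_coef rf) bw).
by rewrite (expansion_psum (regular_coef rg) bw) E.
Qed.

Lemma not_identically_zero_coef f : regular rho f -> not_identically_zero rho f ->
  coef f != 0.
Proof.
move=> rf [w bw fw]; apply: contra_neq fw => E.
rewrite (expansion_psum (regular_coef rf) bw) E /psum.
rewrite (_ : oct_series 0 w = fun=> 0); last first.
  apply/funext => N; rewrite /oct_series /series /= big1 // => i _.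
  exact: oct_mul0r.
exact: (cvg_lim (@norm_hausdorff _ _) (@cvg_cst _ (0 : O) nat \oo _)).
Qed.

Variable al : O.
Hypothesis ball_al : oct_ball rho al.
Hypothesis al_nonreal : ~ oct_is_real al.

Let t := oct_Re al *+ 2.
Let n := oct_nsqr al.
Local Notation D := (quadmul 1 (- t) n).

Lemma oct_nsqr_gt0 : 0 < n.
Proof.
rewrite lt_neqAle oct_nsqr_ge0 andbT eq_sym /n oct_nsqr_eq0.
exact: oct_nonreal_neq0.
Qed.

Lemma delta_neq0 : n != 0. Proof. by rewrite gt_eqF ?oct_nsqr_gt0. Qed.

Let comb1 (V : lmodType R) (c d e : R) (v : V) :
  c *: 0 + d *: v + e *: 0 = d *: v.
Proof. by rewrite !scaler0 add0r addr0. Qed.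

Let comb2 (V : lmodType R) (c d e : R) (v : V) :
  c *: 0 + d *: 0 + e *: v = e *: v.
Proof. by rewrite !scaler0 !add0r. Qed.

Let delta0 : D (sconst 1%:O) 0%N = n%:O.
Proof. by rewrite quadmulE0 /= oct_realZ mulr1. Qed.
Let delta1 : D (sconst 1%:O) 1%N = (- t)%:O.
Proof. by rewrite [LHS]comb1 oct_realZ mulr1. Qed.
Let delta2 : D (sconst 1%:O) 2 = 1%:O.
Proof. by rewrite [LHS]comb2 scale1r. Qed.

Lemma expansion_Delta : expansion rho (Delta al) (D (sconst 1%:O)).
Proof.
apply: (@expansion_finite _ _ _ _ 3) => [k|w].
  by rewrite [LHS]comb2 scaler0.
have S3 (F : nat -> O) : \sum_(i < 3) F i = F 0%N + F 1%N + F 2.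
  by rewrite !big_ord_recr big_ord0 /= add0r.
rewrite (S3 (fun i => oct_pow w i ** D (sconst 1%:O) i)) delta0 delta1 delta2.
rewrite [oct_pow w 2]oct_powS oct_pow1 oct_pow0 oct_mul1l oct_mul1r.
rewrite /Delta /oct_nsq /oct_tr oct_norm_sqr oct_add_conj !oct_mul_realr -/t -/n.
by rewrite scaleNr [RHS]addrC [n%:O + _]addrC addrA.
Qed.

Lemma regular_Delta : regular rho (Delta al).
Proof. by exists (D (sconst 1%:O)); exact: expansion_Delta. Qed.

Lemma convol1l x : convol (sconst 1%:O) x = x.
Proof. by rewrite convol_constl; apply/funext => k; rewrite oct_mul1l. Qed.

Lemma convol_iterl s x y : convol (iter s D x) y = iter s D (convol x y).
Proof. by elim: s => //= s <-; rewrite convol_quadl. Qed.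

Lemma convol_iterr s x y : convol x (iter s D y) = iter s D (convol x y).
Proof. by elim: s => //= s <-; rewrite convol_quadr. Qed.

Lemma star_exp_Delta s : regular rho (star_exp rho (Delta al) s) /\
  coef (star_exp rho (Delta al) s) = iter s D (sconst 1%:O).
Proof.
elim: s => [|s [IH1 IH2]].
  have e1 : expansion rho (fun=> 1%:O) (sconst (1%:O : O)).
    apply: (@expansion_finite _ _ _ _ 1) => // w.
    by rewrite big_ord1 oct_mul1l.
  by split; [exists (sconst 1%:O) | exact: expansion_coef].
split; first exact: regular_star regular_Delta IH1.
rewrite [star_exp _ _ _]/(star rho (Delta al) (star_exp rho (Delta al) s)).
rewrite (coef_star regular_Delta IH1).
by rewrite (expansion_coef expansion_Delta) IH2 convol_quadl convol1l.
Qed.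

Definition delta_divides s x := exists2 h, radial rho h & x = iter s D h.

Lemma dividesP s q : regular rho q ->
  divides rho (star_exp rho (Delta al) s) q <-> delta_divides s (coef q).
Proof.
move=> rq; have [rs Es] := star_exp_Delta s; split=> [[h rh]|[h rh Eh]].
  move=> /(eq_on_ballP rq (regular_star rs rh)) ->.
  exists (coef h); first exact: regular_radial.
  by rewrite (coef_star rs rh) Es convol_iterl convol1l.
exists (psum h); first exact: regular_psum.
have rp := regular_psum rh.
apply/(eq_on_ballP rq (regular_star rs rp)).
by rewrite (coef_star rs rp) Es convol_iterl convol1l coef_psum.
Qed.

(** The existence proved in [delta_division] rules out the default value of [xget], so the chosen
    pair does come from a division. *)
Lemma remainderP f a b : regular rho f -> remainder rho f al = (a, b) ->
  exists2 h, radial rho h & coef f = D h + saffine a b.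
Proof.
move=> rf; rewrite /remainder; set S := [set ab | _].
have SE ab : S ab <-> exists2 h, radial rho h & coef f = D h + saffine ab.1 ab.2.
  have eD h : regular rho h ->
      expansion rho (fun w => star rho (Delta al) h w + (w ** ab.1 + ab.2))
        (D (coef h) + saffine ab.1 ab.2).
    move=> rh; apply: expansionD; last exact: expansion_affine.
    have <- : coef (star rho (Delta al) h) = D (coef h).
      rewrite (coef_star regular_Delta rh).
      by rewrite (expansion_coef expansion_Delta) convol_quadl convol1l.
    exact: (regular_coef (regular_star regular_Delta rh)).
  split=> [[h rh E]|[h rh E]].
    exists (coef h); first exact: regular_radial.
    have e := eD h rh; rewrite -(expansion_coef e).
    exact: ((eq_on_ballP rf (ex_intro _ _ e)).1 E).
  have rp := regular_psum rh; exists (psum h) => //.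
  have e := eD _ rp; refine ((eq_on_ballP rf (ex_intro _ _ e)).2 _).
  by rewrite (expansion_coef e) (coef_psum rh).
have [h [A [B [rh E]]]] := delta_division ball_al (regular_radial rf).
have /SE SAB : exists2 h, radial rho h & coef f = D h + saffine (A, B).1 (A, B).2.
  by exists h.
have := @xgetPex _ (0, 0) S (ex_intro _ (A, B) SAB).
by move=> + E'; rewrite E' => /SE.
Qed.

End RegularFunctions.

(** * Multiplicities *)

Section Multiplicity.
Variables (R : realType) (rho : \bar R).
Hypothesis rho0 : (0 < rho)%E.
Local Notation O := (octonion R).
Local Notation conj := (@oct_conj R).
Local Notation coef := (coef rho).
Implicit Types (f g q : O -> O) (x y h k : nat -> O) (w a b c d A B : O).
Variable al : O.
Hypothesis ball_al : oct_ball rho al.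
Hypothesis al_nonreal : ~ oct_is_real al.

Let t := oct_Re al *+ 2.
Let n := oct_nsqr al.
Local Notation D := (quadmul 1 (- t) n).
Local Notation delta_divides := (delta_divides rho al).

Let n_neq0 : n != 0. Proof. exact: delta_neq0 al_nonreal. Qed.

Lemma conj_class_sqr w : conj_class al w -> w ** w = t *: w - n%:O.
Proof. by move=> /conj_classE[Ew nw]; rewrite oct_sqr Ew nw. Qed.

Lemma conj_class_ball w : conj_class al w -> oct_ball rho w.
Proof. by move=> /conj_classE[_ nw]; rewrite /oct_ball /= (oct_norm_eq nw). Qed.

Lemma value_on_class f h A B w : regular rho f -> radial rho h ->
  coef f = D h + saffine A B -> conj_class al w -> f w = w ** A + B.
Proof.
move=> rf rh fE cw.
apply: (expansion_sphere rh (conj_class_ball cw) (conj_class_sqr cw)).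
by rewrite -fE; exact: regular_coef.
Qed.

Lemma affine_zero A B : al ** A + B = 0 -> conj al ** A + B = 0 -> A = 0 /\ B = 0.
Proof.
move=> E1 E2; have A0 : A = 0.
  have : (al - conj al) ** A = 0.
    by rewrite oct_mulBl; move: (E1); rewrite -E2 => /addIr ->; rewrite subrr.
  case/oct_mul_eq0 => // E; case: (oct_conj_neq al_nonreal).
  by apply/esym/subr0_eq.
by move: E1; rewrite A0 oct_mul0r add0r.
Qed.

Lemma addr_saffine0 x : x + saffine 0 0 = x.
Proof. by apply/funext => -[|[|j]]; rewrite sseqD !saffineE !addr0. Qed.

(** A convergent multiple of Delta vanishes on the class, in particular at [al] and at its
    conjugate; an affine polynomial with two distinct zeros is 0. Uniqueness of the remainder
    follows by subtraction. *)
Lemma saffine_divisible h A B : radial rho h -> D h = saffine A B -> A = 0 /\ B = 0.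
Proof.
move=> rh E.
have ex : expansion rho (fun w => w ** A + B) (D h + saffine 0 0).
  rewrite addr_saffine0 E.
  exact: expansion_affine.
have V w : conj_class al w -> w ** A + B = 0.
  move=> cw; have := expansion_sphere rh (conj_class_ball cw) (conj_class_sqr cw) ex.
  by rewrite oct_mul0r addr0.
by apply: affine_zero; apply: V; [exact: conj_class_refl | exact: conj_class_conj].
Qed.

Let addr_eq_subr (W : zmodType) (u v s s' : W) : u + s = v + s' -> u - v = s' - s.
Proof. by move=> E; rewrite -(addrK s u) E addrAC [v + _]addrC addrK. Qed.

Lemma saffine_unique h k A B A' B' : radial rho h -> radial rho k ->
  D h + saffine A B = D k + saffine A' B' -> A = A' /\ B = B'.
Proof.
move=> rh rk E.
have E' : D (h - k) = saffine (A' - A) (B' - B).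
  rewrite quadmulB -saffineB.
  exact (addr_eq_subr E).
have [/subr0_eq -> /subr0_eq ->] := saffine_divisible (radialB rh rk) E'.
by [].
Qed.

Lemma iter_quad_inj s x y : iter s D x = iter s D y -> x = y.
Proof. by elim: s => [//|s IH] /= /(quadmul_inj n_neq0)/IH. Qed.

Lemma delta_divides_le s s' x : (s' <= s)%N -> delta_divides s x -> delta_divides s' x.
Proof.
move=> ss [h rh ->]; exists (iter (s - s') D h); first exact: radial_iter_quad.
by rewrite -iterD subnKC.
Qed.

Lemma real_octP a : conj a = a -> a = (oct_Re a)%:O.
Proof.
move=> E; apply: (@scalerI _ _ 2%:R); first by rewrite pnatr_eq0.
by rewrite oct_realZ mulr_natl -oct_add_conj E scaler_nat mulr2n.
Qed.

(** A self-conjugate sequence equals its real part, and taking real parts commutes with Delta, so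
    the bound for real sequences applies at any radius between |al| and [rho]. *)
Lemma delta_divides_finite x : radial rho x -> sconj x = x -> x <> 0 ->
  exists s, ~ delta_divides s x.
Proof.
move=> rx cx x0; apply: contrapT => /forallNP H; apply: x0.
have {}H s : delta_divides s x by apply: contrapT; exact: H.
have [r alr rr] := radius_between ball_al.
have r0 : 0 <= r by apply: le_trans (ltW alr); exact: oct_norm_ge0.
have ReB (v : O) : `|oct_Re v| <= 1 * `|v|.
  by case: v => [[[v0 v1] v2] v3]; rewrite mul1r !prod_normE /= !le_max lexx.
have Rq s h : @oct_Re R \o iter s D h = iter s D (@oct_Re R \o h).
  elim: s => //= s IH; rewrite -IH; apply: quadmul_morph; first by [].
    exact: oct_ReD.
  exact: oct_ReZ.
have Re0 : @oct_Re R \o x = 0.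
  apply: (@quadmul_divisible_zero R rho (- t) n r) => //.
  - exact: oct_nsqr_gt0.
  - by rewrite /n -oct_norm_sqr ltrXn2r ?nnegrE ?oct_norm_ge0.
  - exact: radial_bounded_map ReB rx.
  - move=> s; have [h rh xE] := H s; exists (@oct_Re R \o h).
      exact: radial_bounded_map ReB rh.
    by rewrite {1}xE Rq.
apply/funext => k; have := congr1 (fun z : nat -> O => z k) cx.
rewrite /sconj /= => /real_octP ->.
by have := congr1 (fun z : nat -> R => z k) Re0 => /= ->.
Qed.

Lemma delta_divides_max x : radial rho x -> sconj x = x -> x <> 0 ->
  exists s h, [/\ radial rho h, x = iter s D h & ~ delta_divides 1 h].
Proof.
move=> rx cx x0; have [s0 H0] := delta_divides_finite rx cx x0.
elim: s0 H0 => [H|s IH H]; first by case: H; exists x.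
have [[h rh xE]|] := pselect (delta_divides s x); last exact: IH.
exists s, h; split; [exact: rh | exact: xE |] => -[h' rh' hE]; apply: H.
exists h'; [exact: rh' | refine (etrans xE _)].
exact (etrans (congr1 (iter s D) hE) (esym (iterSr s D h'))).
Qed.

(** Divisibility passes to smaller powers of Delta, so at most one exponent qualifies and [xget]
    must return it. *)
Lemma multiplicity_eq f s : regular rho f ->
  delta_divides s (snormal (coef f)) -> ~ delta_divides s.+1 (snormal (coef f)) ->
  multiplicity rho f al = s.
Proof.
move=> rf; rewrite -(coef_normal rho0 rf) => ds ds1.
have rN := regular_normal rho0 rf.
have dP := fun s => dividesP rho0 al s rN.
have Ps : divides rho (star_exp rho (Delta al) s) (Defs.normal_fun rho f) /\
    ~ divides rho (star_exp rho (Delta al) s.+1) (Defs.normal_fun rho f).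
  by split; [exact: (dP s).2 | move=> /(dP s.+1).1].
apply: (@xget_unique _ 0%N _ s) => // s' [/(dP s').1 d1 d2].
have {}d2 : ~ delta_divides s'.+1 (coef (Defs.normal_fun rho f)).
  by move=> /(dP s'.+1).2.
have [ss'|ss'|//] := ltngtP s s'.
  by case: ds1; exact: delta_divides_le d1.
by case: d2; exact: delta_divides_le ds.
Qed.

Lemma multiplicityP f : regular rho f -> not_identically_zero rho f ->
  exists h, [/\ radial rho h, sconj h = h, ~ delta_divides 1 h &
    snormal (coef f) = iter (multiplicity rho f al) D h].
Proof.
move=> rf f0; have rc := regular_radial rho0 rf.
have N0 : snormal (coef f) <> 0.
  by move/snormal_eq0; apply/eqP; exact: not_identically_zero_coef.
have [s [h [rh E nd]]] := delta_divides_max (radial_normal rc) (sconj_normal _) N0.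
(* Conjugation commutes with Delta, and Delta can be cancelled. [delta_prime] asks for cofactors
   with real coefficients. *)
have ch : sconj h = h.
  apply: (@iter_quad_inj s _ _); rewrite -E -sconj_normal E.
  by elim: s {E} => //= s ->; rewrite sconj_quad.
have -> : multiplicity rho f al = s.
  apply: (multiplicity_eq rf); first by exists h; [exact: rh | exact: E].
  move=> [h' rh' E']; apply: nd; exists h'; first exact: rh'.
  apply: (@iter_quad_inj s _ _); refine (etrans (esym E) (etrans E' _)).
  exact (iterSr s D h').
by exists h; split; [exact: rh | exact: ch | exact: nd | exact: E].
Qed.

Let add4A (W : zmodType) (u v w z : W) : u + (v + (w + z)) = u + v + w + z.
Proof. by rewrite !addrA. Qed.

(** The quotient [m] collects everything that multiplies Delta in the expanded product, including
    the constant [a ** c] produced by w^2. *)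
Lemma convol_remainder h k a b c d : radial rho h -> radial rho k ->
  exists2 m, radial rho m &
  convol (D h + saffine a b) (D k + saffine c d) =
  D m + saffine (t *: (a ** c) + (a ** d + b ** c)) (b ** d - n *: (a ** c)).
Proof.
move=> rh rk.
exists (convol h (D k + saffine c d) + convol (saffine a b) k + sconst (a ** c)).
  have r1 := radial_convol rh (radialD (radial_quad 1 (- t) n rk) (radial_affine c d)).
  exact (radialD (radialD r1 (radial_convol (radial_affine a b) rk))
    (radial_const (a ** c))).
refine (etrans (convolDl _ _ _) _).
refine (etrans (f_equal2 (fun u v => u + v) (convol_quadl _ _ _ _ _)
  (convolDr _ _ _)) _).
refine (etrans (congr1 (fun u => _ + u) (f_equal2 (fun u v => u + v)
  (convol_quadr _ _ _ _ _) (convol_affine t n a b c d))) _).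
refine (etrans (add4A _ _ _ _) (congr1 (fun u => u + _) (esym _))).
exact (etrans (quadmulD _ _ _ _ _) (congr1 (fun u => u + _) (quadmulD _ _ _ _ _))).
Qed.

Let affine_mulE (p q p' q' s m : R) w :
  p *: (p' *: (s *: w - m%:O)) + p *: (q' *: w) + (p' *: (q *: w) + (q * q')%:O) =
  (s * (p * p') + (p * q' + q * p')) *: w + (q * q' - m * (p * p'))%:O.
Proof.
elim/oct8_ind: w => x0 x1 x2 x3 x4 x5 x6 x7.
by rewrite !octE; congr mk8; ring.
Qed.

Let real_affine_zero (p q : R) : p *: al + q%:O = 0 -> p = 0 /\ q = 0.
Proof.
move=> E; have p0 : p = 0.
  apply: contrapT => /eqP p0; apply: al_nonreal; exists (p^-1 * - q).
  rewrite -oct_realZ oct_realN; move: E => /addr0_eq <-.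
  by rewrite opprK scalerA mulVf // scale1r.
by move: E; rewrite p0 scale0r add0r => /(congr1 (@oct_Re R)).
Qed.

(** Uniqueness makes the remainders of self-conjugate sequences real. Evaluating real polynomials at
    [al] is multiplicative, so the vanishing remainder of the product becomes a product of two
    octonions equal to 0. One factor vanishes, and then so do its two real coefficients, [al] being
    non-real. *)
Lemma delta_prime x y : radial rho x -> radial rho y -> sconj x = x -> sconj y = y ->
  delta_divides 1 (convol x y) -> delta_divides 1 x \/ delta_divides 1 y.
Proof.
have rem z : radial rho z -> sconj z = z -> exists h (u v : R),
    radial rho h /\ z = D h + saffine u%:O v%:O.
  move=> rz cz; have [h [A [B [rh E]]]] := delta_division ball_al rz.
  exists h, (oct_Re A), (oct_Re B); split; first exact: rh.
  have [cA cB] : conj A = A /\ conj B = B.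
    apply: (saffine_unique (radial_conj rh) rh).
    by rewrite -sconj_quad -sconj_affine -sconjD -E.
  by rewrite -(real_octP cA) -(real_octP cB).
move=> rx ry cx cy [h rh Eh].
have [h1 [p1 [q1 [rh1 E1]]]] := rem x rx cx.
have [h2 [p2 [q2 [rh2 E2]]]] := rem y ry cy.
have [m rm Em] := convol_remainder p1%:O q1%:O p2%:O q2%:O rh1 rh2.
have E := etrans (esym Em) (etrans (f_equal2 (@convol R) (esym E1) (esym E2)) Eh).
have [A0 B0] := saffine_unique rm rh (etrans E (esym (addr_saffine0 (D h)))).
have : (p1 *: al + q1%:O) ** (p2 *: al + q2%:O) = 0.
  rewrite oct_mulDl !oct_mulDr !oct_scaleAl !oct_scaleAr oct_sqr -/t -/n.
  move: A0 B0; rewrite !oct_mul_reall !oct_mul_realr !oct_realZ -oct_realN -!oct_realD.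
  move=> /(congr1 (@oct_Re R)) /= A0 /(congr1 (@oct_Re R)) /= B0.
  have {}A0 : t * (p1 * p2) + (p1 * q2 + q1 * p2) = 0 := A0.
  have {}B0 : q1 * q2 - n * (p1 * p2) = 0 := B0.
  by rewrite affine_mulE A0 B0 scale0r addr0.
have D1 z k u v : z = D k + saffine u%:O v%:O -> radial rho k ->
    u *: al + v%:O = 0 -> delta_divides 1 z.
  move=> Ez rk /real_affine_zero[u0 v0]; exists k; first exact: rk.
  by refine (etrans Ez _); rewrite u0 v0; exact: addr_saffine0.
by case/oct_mul_eq0 => E0; [left; exact: D1 E1 rh1 E0 | right; exact: D1 E2 rh2 E0].
Qed.

Lemma multiplicity_star f g : regular rho f -> regular rho g ->
  not_identically_zero rho f -> not_identically_zero rho g ->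
  multiplicity rho (star rho f g) al =
  (multiplicity rho f al + multiplicity rho g al)%N.
Proof.
move=> rf rg f0 g0.
have [h [rh ch nh Eh]] := multiplicityP rf f0.
have [k [rk ck nk Ek]] := multiplicityP rg g0.
have EN : snormal (coef (star rho f g)) =
    iter (multiplicity rho f al + multiplicity rho g al) D (convol h k).
  refine (etrans (congr1 (@snormal R) (coef_star rho0 rf rg)) _).
  refine (etrans (snormal_convol _ _) (etrans (f_equal2 (@convol R) Eh Ek) _)).
  refine (etrans (convol_iterl _ _ _ _) _).
  refine (etrans (congr1 (iter _ D) (convol_iterr _ _ _ _)) _).
  exact (esym (iterD _ _ D _)).
apply: (multiplicity_eq (regular_star rho0 rf rg)).
  by exists (convol h k); [exact: (radial_convol rh rk) | exact: EN].
move=> [m rm Em]; have [] := delta_prime rh rk ch ck.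
- exists m; first exact: rm.
  apply: (@iter_quad_inj (multiplicity rho f al + multiplicity rho g al) _ _).
  refine (etrans (esym EN) (etrans Em _)); exact (iterSr _ D m).
- exact: nh.
- exact: nk.
Qed.

Lemma multiplicity_eq0P f : regular rho f -> not_identically_zero rho f ->
  multiplicity rho f al = 0%N <-> ~ delta_divides 1 (snormal (coef f)).
Proof.
move=> rf f0; split=> [m0|nd].
  have [h [rh _ nh Eh]] := multiplicityP rf f0.
  by move: Eh; rewrite m0 => ->.
apply: (multiplicity_eq rf) => //.
by exists (snormal (coef f)) => //; exact: radial_normal (regular_radial rho0 rf).
Qed.

Lemma normal_divisible f h A B : radial rho h -> coef f = D h + saffine A B ->
  delta_divides 1 (snormal (coef f)) <->
  oct_nsqr B = n * oct_nsqr A /\ oct_dot A B = - oct_Re al * oct_nsqr A.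
Proof.
move=> rh Ef; have [m rm Em] := convol_remainder A B (conj A) (conj B) rh (radial_conj rh).
have EN : snormal (coef f) = D m + saffine (t *: (A ** conj A) + (A ** conj B + B ** conj A))
    (B ** conj B - n *: (A ** conj A)).
  refine (etrans _ Em); rewrite /snormal Ef; congr convol.
  refine (etrans (sconjD _ _) (f_equal2 (fun u v => u + v) (sconj_quad _ _ _ _) _)).
  exact: sconj_affine.
have iff1 : delta_divides 1 (snormal (coef f)) <->
    t *: (A ** conj A) + (A ** conj B + B ** conj A) = 0 /\
    B ** conj B - n *: (A ** conj A) = 0.
  split=> [[k rk Ek]|[E1 E2]].
    have E0 := etrans (esym EN) Ek.
    exact: saffine_unique rm rk (etrans E0 (esym (addr_saffine0 (D k)))).
  exists m; first exact: rm.
  by refine (etrans EN _); rewrite E1 E2; exact: addr_saffine0.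
apply: (iff_trans iff1).
rewrite !oct_mul_conjr oct_dot_conj !oct_realZ -oct_realN -!oct_realD.
have r0 (r : R) : r%:O = 0 <-> r = 0.
  by split=> [/(congr1 (@oct_Re R))|->].
split=> [[/r0 E1 /r0 E2]|[E1 E2]].
  by split; move: E1 E2; rewrite /t; lra.
by split; apply/r0; rewrite ?E1 ?E2 /t; ring.
Qed.

End Multiplicity.

(** * Zeros of products *)

Section Associators.
Variable R : realType.
Local Notation O := (octonion R).
Local Notation conj := (@oct_conj R).
Implicit Types (x y z a b c u w : O).

Lemma oct_conjE_tr x : conj x = (oct_Re x *+ 2)%:O - x.
Proof. by rewrite -oct_add_conj addrC addKr. Qed.

Lemma oct_dotC x y : oct_dot x y = oct_dot y x.
Proof. by rewrite /oct_dot -oct_Re_conj oct_conjM oct_conjK. Qed.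

Lemma oct_assocDl x y z w : oct_assoc (x + y) z w = oct_assoc x z w + oct_assoc y z w.
Proof. by rewrite /oct_assoc !oct_mulDl opprD addrACA. Qed.

Lemma oct_assocZl (r : R) x y z : oct_assoc (r *: x) y z = r *: oct_assoc x y z.
Proof. by rewrite /oct_assoc !oct_scaleAl scalerBr. Qed.

Lemma oct_assocNl x y z : oct_assoc (- x) y z = - oct_assoc x y z.
Proof. by rewrite -(scaleN1r x) oct_assocZl scaleN1r. Qed.

Lemma oct_assoc_reall (r : R) x y : oct_assoc r%:O x y = 0.
Proof. by rewrite /oct_assoc !oct_mul_reall oct_scaleAl subrr. Qed.

Lemma oct_assoc_conjl x y z : oct_assoc (conj x) y z = - oct_assoc x y z.
Proof. by rewrite oct_conjE_tr oct_assocDl oct_assoc_reall oct_assocNl add0r. Qed.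

Lemma oct_assoc_conjm x y z : oct_assoc x (conj y) z = - oct_assoc x y z.
Proof.
by rewrite (oct_assocC x (conj y)) oct_assoc_conjl (oct_assocC x y).
Qed.

Lemma oct_assoc0 x y z : (x ** y) ** z = x ** (y ** z) <-> oct_assoc x y z = 0.
Proof. by split=> [E|/subr0_eq //]; rewrite /oct_assoc E subrr. Qed.

Lemma oct_assoc_conjugate x y z : oct_assoc x y z = 0 ->
  oct_assoc ((x ** y) ** conj x) x z = 0.
Proof.
move=> E; have E1 : oct_assoc (x ** y) x z = 0.
  by rewrite oct_assocC oct_assoc_mull E oct_mul0l oppr0.
rewrite oct_conjE_tr oct_mulBr oct_mul_realr oct_assocDl oct_assocZl oct_assocNl.
rewrite E1 scaler0 add0r (oct_assocC ((x ** y) ** x)) oct_assoc_mulr.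
by rewrite oct_assoc_mull E oct_mul0l oct_mul0r !oppr0.
Qed.

(** Writing the conjugate of [w] as a real number minus [w] reduces the claim to the associators of
    [a] and of [a ** w]; a Moufang identity settles the latter. *)
Lemma oct_assoc_shift a b w c : oct_assoc b w c = 0 -> oct_assoc a (conj w) c = 0 ->
  oct_assoc (b + a ** conj w) w c = 0.
Proof.
move=> Eb; rewrite oct_assoc_conjm => /eqP; rewrite oppr_eq0 => /eqP Ea.
rewrite oct_assocDl Eb add0r oct_conjE_tr oct_mulBr oct_mul_realr oct_assocDl.
rewrite oct_assocZl Ea scaler0 add0r oct_assocNl (oct_assocC (a ** w)).
by rewrite oct_assoc_mulr (oct_assocC w a) Ea oppr0 oct_mul0r !oppr0.
Qed.

(** With v = (u w) u^-1 one has v u = u w, so cancelling [c] amounts to the vanishing of the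
    associator of [v], [u], [c]. This gives the conjugation formula in the second statement. *)
Lemma oct_quotient_assoc u w c : u != 0 -> u ** c != 0 -> oct_assoc u w c = 0 ->
  ((u ** w) ** c) ** oct_inv (u ** c) = (u ** w) ** oct_inv u.
Proof.
move=> u0 uc0 E.
have v1 : oct_assoc ((u ** w) ** oct_inv u) u c = 0.
  by rewrite oct_invE oct_scaleAr oct_assocZl oct_assoc_conjugate ?scaler0.
have := (oct_assoc0 _ _ _).2 v1; rewrite (oct_mulVK (u ** w) u0) => ->.
exact: oct_mulK.
Qed.

(** The subalgebra is only assumed to contain the remainder coefficients. It contains the zero as
    well, since [w] is - b a^-1 and conjugates and inverses stay inside. *)
Lemma subalgebra_root (S : set O) a b w : associative_subalgebra S ->
  S a -> S b -> a != 0 -> w ** a + b = 0 -> S w /\ S (conj w).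
Proof.
move=> [S0 SD SZ SM _] Sa Sb a0 E.
have na0 : oct_nsqr a != 0 by rewrite oct_nsqr_eq0.
have SZ' (r : R) x : S x -> S (r *: x) by rewrite -oct_mul_reall; exact: SZ.
have SN x : S x -> S (- x) by rewrite -scaleN1r; exact: SZ'.
(* A nonzero [a] brings the reals into [S], because the real octonion [oct_nsqr a] is a combination
   of [a] and [a ** a]. *)
have Sr (r : R) : S r%:O.
  have -> : r%:O = (r / oct_nsqr a) *: ((oct_Re a *+ 2) *: a - a ** a) :> O.
    by rewrite oct_sqr opprB addrC subrK oct_realZ divfK.
  by apply: (SZ'); apply: (SD); [exact: SZ' | apply: (SN); exact: SM].
have SC x : S x -> S (conj x).
  by move=> Sx; rewrite oct_conjE_tr; apply: (SD) => //; exact: SN.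
have Sw : S w.
  rewrite -(oct_mulK w a0) (_ : w ** a = - b); last by apply/eqP; rewrite -addr_eq0 E.
  by apply: (SM); [exact: SN | rewrite oct_invE; apply: (SZ'); exact: SC].
by split=> //; exact: SC.
Qed.

End Associators.

(** * Zeros on the class in terms of the remainder *)

Section Zeros.
Variables (R : realType) (rho : \bar R).
Hypothesis rho0 : (0 < rho)%E.
Local Notation O := (octonion R).
Local Notation conj := (@oct_conj R).
Local Notation coef := (coef rho).
Implicit Types (f g : O -> O) (h k : nat -> O) (w a b c d A B : O).
Variable al : O.
Hypothesis ball_al : oct_ball rho al.
Hypothesis al_nonreal : ~ oct_is_real al.

Let t := oct_Re al *+ 2.
Let n := oct_nsqr al.
Local Notation D := (quadmul 1 (- t) n).
Local Notation divisible f := (delta_divides rho al 1 (snormal (coef f))).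

Lemma multiplicity_class f w : conj_class al w ->
  multiplicity rho f w = multiplicity rho f al.
Proof.
move=> /conj_classE[Ew nw]; suff E : Delta w = Delta al by rewrite /multiplicity E.
by apply/funext => x; rewrite /Delta /oct_tr /oct_nsq !oct_norm_sqr !oct_add_conj Ew nw.
Qed.

Section Remainder.
Variables (f : O -> O) (h : nat -> O) (A B : O).
Hypotheses (rf : regular rho f) (rh : radial rho h).
Hypothesis Ef : coef f = D h + saffine A B.

Let f_class w : conj_class al w -> f w = w ** A + B.
Proof. exact: (value_on_class rho0 ball_al rf rh Ef). Qed.

Let class_ball w : conj_class al w -> oct_ball rho w.
Proof. exact: conj_class_ball. Qed.

Lemma spherical_zeroE : spherical_zero rho f al <-> A = 0 /\ B = 0.
Proof.
split=> [[_ H]|[A0 B0]].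
  have cl := conj_class_refl al_nonreal; have cc := conj_class_conj al_nonreal.
  have E1 : al ** A + B = 0 by rewrite -(f_class cl); have [] := H _ cl.
  have E2 : conj al ** A + B = 0 by rewrite -(f_class cc); have [] := H _ cc.
  exact: (affine_zero al_nonreal E1 E2).
split=> // w cw; split; first exact: class_ball.
by rewrite f_class // A0 B0 oct_mul0r addr0.
Qed.

Lemma isolated_zeroE w : conj_class al w ->
  isolated_zero rho f w <-> A != 0 /\ w ** A + B = 0.
Proof.
move=> cw; rewrite /isolated_zero (conj_class_eq al_nonreal cw) -(f_class cw).
have nS : conj_class al `<=` zero_set rho f <-> A = 0 /\ B = 0.
  rewrite -spherical_zeroE; split=> [H|[]//]; by split.
split=> [[_ [_ fw] H]|[A0 fw]].
  split=> //; apply/eqP => A0; apply: H; apply/nS; split=> //.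
  by move: fw; rewrite (f_class cw) A0 oct_mul0r add0r.
split; first exact: conj_class_nonreal cw.
  by split; first exact: class_ball.
by move/nS => -[A0' _]; rewrite A0' eqxx in A0.
Qed.

Lemma isolated_zero_divisible w : conj_class al w -> isolated_zero rho f w ->
  divisible f.
Proof.
move=> cw /(isolated_zeroE cw)[A0 E]; apply/(normal_divisible ball_al al_nonreal rh Ef).
have -> : B = - (w ** A) by apply/eqP; rewrite -addr_eq0 addrC E.
have [Ew nw] := conj_classE cw; rewrite oct_nsqrN oct_nsqrM nw; split=> //.
by rewrite oct_dotC oct_dotNl oct_dot_mull Ew mulNr.
Qed.

Lemma divisible_isolated_zero : divisible f -> A != 0 ->
  conj_class al (- B ** oct_inv A) /\ isolated_zero rho f (- B ** oct_inv A).
Proof.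
move=> /(normal_divisible ball_al al_nonreal rh Ef)[nB dB] A0; set w := - B ** oct_inv A.
have wA : w ** A = - B by exact: oct_mulVK.
have nA : oct_nsqr A != 0 by rewrite oct_nsqr_eq0.
have cw : conj_class al w.
  apply/(conj_classP _ al_nonreal); split; apply: (mulIf nA).
    by rewrite -oct_dot_mull wA oct_dotNl oct_dotC dB; ring.
  by rewrite -oct_nsqrM wA oct_nsqrN nB.
by split=> //; apply/(isolated_zeroE cw); rewrite wA addNr.
Qed.

Lemma divisible_zero : divisible f -> A = 0 -> B = 0.
Proof.
move=> /(normal_divisible ball_al al_nonreal rh Ef)[nB _] A0; apply/eqP; rewrite -oct_nsqr_eq0 nB A0.
by rewrite /oct_nsqr oct_mul0l mulr0.
Qed.

Lemma nonvanishing_not_divisible : (forall w, conj_class al w -> f w <> 0) ->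
  ~ divisible f.
Proof.
move=> f0 dv; have [A0|A0] := eqVneq A 0.
  apply: (f0 al (conj_class_refl al_nonreal)).
  by rewrite (f_class (conj_class_refl al_nonreal)) A0 (divisible_zero dv A0) oct_mul0r addr0.
by have [cw [_ [_ fw] _]] := divisible_isolated_zero dv A0; exact: f0 cw fw.
Qed.

End Remainder.

Lemma normal_divisible_star f g : regular rho f -> regular rho g ->
  divisible f \/ divisible g -> divisible (star rho f g).
Proof.
move=> rf rg H.
have Nf := radial_normal (regular_radial rho0 rf).
have Ng := radial_normal (regular_radial rho0 rg).
have E := etrans (congr1 (@snormal R) (coef_star rho0 rf rg)) (snormal_convol _ _).
case: H => -[h rh Eh].
  exists (convol h (snormal (coef g))); first exact: (radial_convol rh Ng).
  refine (etrans E (etrans (congr1 (fun x => convol x _) Eh) _)).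
  exact: convol_quadl.
exists (convol (snormal (coef f)) h); first exact: (radial_convol Nf rh).
refine (etrans E (etrans (congr1 (fun x => convol _ x) Eh) _)).
exact: convol_quadr.
Qed.

Lemma star_remainder f g h k a b c d : regular rho f -> regular rho g ->
  radial rho h -> radial rho k ->
  coef f = D h + saffine a b -> coef g = D k + saffine c d ->
  exists2 m, radial rho m & coef (star rho f g) =
    D m + saffine (t *: (a ** c) + (a ** d + b ** c)) (b ** d - n *: (a ** c)).
Proof.
move=> rf rg rh rk Ef Eg; have [m rm Em] := convol_remainder al a b c d rh rk.
exists m; first exact: rm.
exact: etrans (coef_star rho0 rf rg) (etrans (f_equal2 (@convol R) Ef Eg) Em).
Qed.

End Zeros.

(** * Zeros of a star product on the class *)

Section StarZeros.
Variables (R : realType) (rho : \bar R).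
Hypothesis rho0 : (0 < rho)%E.
Local Notation O := (octonion R).
Local Notation conj := (@oct_conj R).
Variables (f g : O -> O).
Hypotheses (rf : regular rho f) (rg : regular rho g).
Hypotheses (f0 : not_identically_zero rho f) (g0 : not_identically_zero rho g).
Variable al : O.
Hypothesis ball_al : oct_ball rho al.
Hypothesis al_nonreal : ~ oct_is_real al.
Variables (a b c d : O) (h k : nat -> O).
Local Notation D := (quadmul 1 (- (oct_Re al *+ 2)) (oct_nsqr al)).
Hypotheses (rh : radial rho h) (rk : radial rho k).
Hypotheses (Ef : coef rho f = D h + saffine a b) (Eg : coef rho g = D k + saffine c d).

Let A : O := (oct_Re al *+ 2) *: (a ** c) + (a ** d + b ** c).
Let B : O := b ** d - oct_nsqr al *: (a ** c).
Local Notation divisible q := (delta_divides rho al 1 (snormal (coef rho q))).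
Implicit Types (w : O) (s : nat).

(** The zero is always - B A^-1. The equations for [X] and [Y] let each case of the theorem supply
    its own expressions for numerator and denominator. *)
Lemma star_isolated_zero s (X Y : O) : divisible f \/ divisible g ->
  X = - B -> Y = A -> A <> 0 ->
  multiplicity rho (star rho f g) al = s ->
  exists w, [/\ conj_class al w, isolated_zero rho (star rho f g) w,
    multiplicity rho (star rho f g) w = s & w = X ** oct_inv Y].
Proof.
move=> dv -> -> A0 ms.
have [m rm Es] := star_remainder rho0 rf rg rh rk Ef Eg.
have rs := regular_star rho0 rf rg.
have [cw iw] := divisible_isolated_zero rho0 ball_al al_nonreal rs rm Es
  (normal_divisible_star rho0 rf rg dv) (introN eqP A0).
exists (- B ** oct_inv A); split; [exact: cw | exact: iw | | by []].
by rewrite (multiplicity_class rho _ cw).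
Qed.

Lemma star_remainder_eq0 : divisible f \/ divisible g -> A = 0 -> B = 0.
Proof.
move=> dv A0.
have [m rm Es] := star_remainder rho0 rf rg rh rk Ef Eg.
exact: (divisible_zero ball_al al_nonreal rm Es (normal_divisible_star rho0 rf rg dv) A0).
Qed.

Lemma star_spherical_zero : A = 0 -> B = 0 -> spherical_zero rho (star rho f g) al.
Proof.
move=> A0 B0; have [m rm Es] := star_remainder rho0 rf rg rh rk Ef Eg.
by apply/(spherical_zeroE rho0 ball_al al_nonreal (regular_star rho0 rf rg) rm Es).
Qed.

(* If both [A] and [B] vanish, taking the norm of [A = 0] and its inner product
   with [a c] transfers the divisibility of N(f) to that of N(g). *)
Lemma star_left_root w : conj_class al w -> a != 0 -> w ** a + b = 0 -> A = 0 ->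
  divisible g.
Proof.
move=> cw a0 /addr0_eq Eb A0; have [Ew nw] := conj_classE cw.
have na : oct_nsqr a != 0 by rewrite oct_nsqr_eq0.
(* Substituting b = - w a and conj w = 2 Re(w) - w turns [A] into a d + (conj w a) c. *)
have E : a ** d = - ((conj w ** a) ** c).
  apply/eqP; rewrite -addr_eq0 -A0 /A -Eb oct_conjE_tr Ew oct_mulBl oct_mul_reall.
  by rewrite oct_mulBl oct_scaleAl oct_mulNl addrCA.
apply/(normal_divisible ball_al al_nonreal rk Eg); split; apply: (mulfI na).
  by rewrite -(oct_nsqrM a d) E oct_nsqrN !oct_nsqrM oct_nsqr_conj nw; ring.
rewrite -(oct_dotMl a c d) E oct_dotC oct_dotNl oct_dotMr oct_dot_mull oct_Re_conj Ew.
by ring.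
Qed.

Lemma star_right_root w : conj_class al w -> c != 0 -> w ** c + d = 0 -> A = 0 ->
  divisible f.
Proof.
move=> cw c0 /addr0_eq Ed A0; have [Ew nw] := conj_classE cw.
have nc : oct_nsqr c != 0 by rewrite oct_nsqr_eq0.
have E : b ** c = - (a ** (conj w ** c)).
  apply/eqP; rewrite -addr_eq0 -A0 /A -Ed oct_conjE_tr Ew oct_mulBl oct_mul_reall.
  by rewrite oct_mulBr oct_scaleAr oct_mulNr addrC -addrA [- _ + _]addrC.
apply/(normal_divisible ball_al al_nonreal rh Ef); split; apply: (mulIf nc).
  by rewrite -(oct_nsqrM b c) E oct_nsqrN !oct_nsqrM oct_nsqr_conj nw; ring.
rewrite -(oct_dotMr a b c) E oct_dotC oct_dotNl oct_dotMl oct_dot_mull oct_Re_conj Ew.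
by ring.
Qed.

End StarZeros.

(** * The four statements on zeros of a product *)

Theorem theorem9 (R : realType) (rho : \bar R) (hrho : (0 < rho)%E)
    (f g : octonion R -> octonion R)
    (hf : regular rho f) (hg : regular rho g)
    (hf0 : not_identically_zero rho f) (hg0 : not_identically_zero rho g)
    (al : octonion R) (hal : oct_ball rho al) (hal_nonreal : ~ oct_is_real al)
    (a b c d : octonion R)
    (hrf : remainder rho f al = (a, b)) (hrg : remainder rho g al = (c, d)) :
  [/\ (* (1) *)
      forall s : nat,
        isolated_zero rho f al -> multiplicity rho f al = s ->
        (forall w, conj_class al w -> g w <> 0) ->
        exists al' : octonion R,
          [/\ conj_class al al',
              isolated_zero rho (star rho f g) al',
              multiplicity rho (star rho f g) al' = s,
              a ** d + (oct_conj al ** a) ** c <> 0 &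
              al' = ((al ** a) ** d + oct_nsq al ** (a ** c))
                      ** oct_inv (a ** d + (oct_conj al ** a) ** c)]
          /\
          ((al ** a) ** d = al ** (a ** d) ->
           oct_nsq al ** (a ** c) = al ** ((oct_conj al ** a) ** c) ->
           al' = al)
          /\
          (oct_is_real a \/
           (exists A : set (octonion R),
              associative_subalgebra A /\ [/\ A a, A b, A c & A d]) ->
           (al ** a) ** d = al ** (a ** d) /\
           oct_nsq al ** (a ** c) = al ** ((oct_conj al ** a) ** c)),
      (* (2) *)
      forall (be : octonion R) (t : nat),
        (forall w, conj_class al w -> f w <> 0) ->
        conj_class al be -> isolated_zero rho g be ->
        multiplicity rho g be = t ->
        exists be' : octonion R,
          [/\ conj_class al be',
              isolated_zero rho (star rho f g) be',
              multiplicity rho (star rho f g) be' = t,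
              b ** c + a ** (oct_conj be ** c) <> 0 &
              be' = (b ** (be ** c) + oct_nsq al ** (a ** c))
                      ** oct_inv (b ** c + a ** (oct_conj be ** c))]
          /\
          (b ** (be ** c) = (b ** be) ** c ->
           a ** (oct_conj be ** c) = (a ** oct_conj be) ** c ->
           be' = ((b + a ** oct_conj be) ** be) ** oct_inv (b + a ** oct_conj be))
          /\
          (oct_is_real c \/
           (exists A : set (octonion R),
              associative_subalgebra A /\ [/\ A a, A b, A c & A d]) ->
           b ** (be ** c) = (b ** be) ** c /\
           a ** (oct_conj be ** c) = (a ** oct_conj be) ** c),
      (* (3) *)
      forall (be : octonion R) (s t : nat),
        isolated_zero rho f al -> multiplicity rho f al = s ->
        conj_class al be -> isolated_zero rho g be ->
        multiplicity rho g be = t ->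
        (a ** (be ** c) = (oct_conj al ** a) ** c ->
         spherical_zero rho (star rho f g) al /\
         multiplicity rho (star rho f g) al = (s + t)%N)
        /\
        (a ** (be ** c) <> (oct_conj al ** a) ** c ->
         exists ga : octonion R,
           [/\ conj_class al ga,
               isolated_zero rho (star rho f g) ga,
               multiplicity rho (star rho f g) ga = (s + t)%N &
               ga = (- ((al ** a) ** (be ** c)) + oct_nsq al ** (a ** c))
                      ** oct_inv (- (a ** (be ** c)) + (oct_conj al ** a) ** c)])
    & (* (4) *)
      forall s t : nat,
        spherical_zero rho f al \/ spherical_zero rho g al ->
        multiplicity rho f al = s -> multiplicity rho g al = t ->
        spherical_zero rho (star rho f g) al /\
        multiplicity rho (star rho f g) al = (s + t)%N].
Proof.
have rho0 := hrho.
have [h rh Ef] := remainderP rho0 hal hf hrf.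
have [k rk Eg] := remainderP rho0 hal hg hrg.
have cal := conj_class_refl hal_nonreal.
pose A : octonion R := (oct_Re al *+ 2) *: (a ** c) + (a ** d + b ** c).
pose B : octonion R := b ** d - oct_nsqr al *: (a ** c).
have ms := multiplicity_star rho0 hal hal_nonreal hf hg hf0 hg0.
have nE x : oct_nsq al ** x = oct_nsqr al *: x.
  by rewrite /oct_nsq oct_mul_reall oct_norm_sqr.
have conjl w x : conj_class al w -> oct_conj w ** x = (oct_Re al *+ 2) *: x - w ** x.
  by move=> /conj_classE[Ew _]; rewrite oct_conjE_tr Ew oct_mulBl oct_mul_reall.
have al_isolated := isolated_zeroE rho0 hal hal_nonreal hf rh Ef.
have be_isolated := isolated_zeroE rho0 hal hal_nonreal hg rk Eg.
have f_divisible := isolated_zero_divisible rho0 hal hal_nonreal hf rh Ef.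
have g_divisible := isolated_zero_divisible rho0 hal hal_nonreal hg rk Eg.
have f_nonvanishing := nonvanishing_not_divisible rho0 hal hal_nonreal hf rh Ef.
have g_nonvanishing := nonvanishing_not_divisible rho0 hal hal_nonreal hg rk Eg.
have mf0 := multiplicity_eq0P rho0 hal hal_nonreal hf hf0.
have mg0 := multiplicity_eq0P rho0 hal hal_nonreal hg hg0.
have star_zero := star_isolated_zero rho0 hf hg hal hal_nonreal rh rk Ef Eg.
have star_eq0 := star_remainder_eq0 rho0 hf hg hal hal_nonreal rh rk Ef Eg.
have star_sph := star_spherical_zero rho0 hf hg hal hal_nonreal rh rk Ef Eg.
split.
- move=> s iso mfs g_nz.
  have [a0 Eb] := (al_isolated al cal).1 iso.
  have dvf := f_divisible al cal iso.
  have ndg := g_nonvanishing g_nz.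
  have /addr0_eq Eb' := Eb.
  have AE : a ** d + (oct_conj al ** a) ** c = A.
    by rewrite (conjl _ _ cal) oct_mulBl oct_scaleAl /A -Eb' oct_mulNl addrCA.
  have BE : (al ** a) ** d + oct_nsq al ** (a ** c) = - B.
    by rewrite nE /B -Eb' oct_mulNl opprD !opprK.
  (* If [A] were 0, [star_left_root] would make N(g) divisible by Delta and so give [g] a zero on
     the class. *)
  have A0 : A <> 0.
    by move=> A0; apply: ndg; exact: (star_left_root hal hal_nonreal rk Eg cal a0 Eb A0).
  have mst : multiplicity rho (star rho f g) al = s.
    by rewrite ms mfs (mg0.2 ndg) addn0.
  have [al' [c' i' m' E']] := star_zero s _ _ (or_introl dvf) BE AE A0 mst.
  exists al'; split.
    by split; [exact: c' | exact: i' | exact: m' | rewrite AE; exact: A0 | exact: E'].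
  split=> [E1 E2|].
    (* The two conditions say that the numerator is [al] times the denominator, so right division
       returns [al]. *)
    have Y0 : a ** d + (oct_conj al ** a) ** c != 0 by rewrite AE; exact/eqP.
    rewrite E' E1 E2.
    exact (etrans (congr1 (fun x => x ** _) (esym (oct_mulDr _ _ _))) (oct_mulK _ Y0)).
  case=> [[r ar]|[S [SA [Sa Sb Sc Sd]]]].
    rewrite ar; split; first by rewrite oct_mul_realr oct_mul_reall oct_scaleAl oct_scaleAr.
    rewrite nE oct_mul_reall oct_mul_realr (oct_scaleAl r) (oct_scaleAr r) oct_mul_conjK.
    by rewrite scalerA mulrC -scalerA.
  have [Sal Sal'] := subalgebra_root SA Sa Sb a0 Eb.
  have [_ _ _ SM SAA] := SA.
  split; first exact: (SAA _ _ _ Sal Sa Sd).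
  by rewrite nE (SAA _ _ _ Sal' Sa Sc) oct_mul_conjK.
- move=> be t f_nz cb iso mgt.
  have [c0 Ed] := (be_isolated be cb).1 iso.
  have dvg := g_divisible be cb iso.
  have ndf := f_nonvanishing f_nz.
  have /addr0_eq Ed' := Ed.
  have [Eb nb] := conj_classE cb.
  have AE : b ** c + a ** (oct_conj be ** c) = A.
    rewrite (conjl _ _ cb) oct_mulBr oct_scaleAr /A -Ed' oct_mulNr.
    by rewrite addrC -!addrA.
  have BE : b ** (be ** c) + oct_nsq al ** (a ** c) = - B.
    by rewrite nE /B -Ed' oct_mulNr opprD !opprK.
  have A0 : A <> 0.
    by move=> A0; apply: ndf; exact: (star_right_root hal hal_nonreal rh Ef cb c0 Ed A0).
  have mst : multiplicity rho (star rho f g) al = t.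
    by rewrite ms (mf0.2 ndf) -(multiplicity_class rho g cb) mgt.
  have [be' [c' i' m' E']] := star_zero t _ _ (or_intror dvg) BE AE A0 mst.
  exists be'; split.
    by split; [exact: c' | exact: i' | exact: m' | rewrite AE; exact: A0 | exact: E'].
  split=> [E1 E2|].
    (* Since (a conj be) be = n a, the numerator is (u be) c and the denominator u c. The two
       assumed identities make the associator of [u], [be], [c] vanish, which allows [c] to
       cancel. *)
    set u := b + a ** oct_conj be.
    have Y : b ** c + a ** (oct_conj be ** c) = u ** c by rewrite E2 oct_mulDl.
    have X : b ** (be ** c) + oct_nsq al ** (a ** c) = (u ** be) ** c.
      have ub : u ** be = b ** be + oct_nsqr al *: a.
        rewrite /u oct_mulDl -nb -(oct_nsqr_conj be); congr (_ + _).
        by have := oct_mulK_conj (oct_conj be) a; rewrite oct_conjK.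
      by rewrite E1 nE ub oct_mulDl oct_scaleAl.
    have uc0 : u ** c != 0 by rewrite -Y AE; exact/eqP.
    have u0 : u != 0 by apply: contra_neq uc0 => ->; rewrite oct_mul0l.
    have u1 := oct_assoc_shift ((oct_assoc0 _ _ _).1 (esym E1))
      ((oct_assoc0 _ _ _).1 (esym E2)).
    rewrite E' X Y; exact (oct_quotient_assoc u0 uc0 u1).
  case=> [[r cr]|[S [SA [Sa Sb Sc Sd]]]].
    by rewrite cr; split; rewrite 2!oct_mul_realr oct_scaleAr.
  have [Sal Sal'] := subalgebra_root SA Sc Sd c0 Ed.
  have [_ _ _ _ SAA] := SA.
  by split; [exact: (esym (SAA _ _ _ Sb Sal Sc)) | exact: (esym (SAA _ _ _ Sa Sal' Sc))].
- move=> be s t isof mfs cb isog mgt.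
  have [a0 Eb] := (al_isolated al cal).1 isof.
  have [c0 Ed] := (be_isolated be cb).1 isog.
  have dvf := f_divisible al cal isof.
  have /addr0_eq Eb' := Eb; have /addr0_eq Ed' := Ed.
  have AE : - (a ** (be ** c)) + (oct_conj al ** a) ** c = A.
    rewrite (conjl _ _ cal) oct_mulBl oct_scaleAl /A -Eb' -Ed' oct_mulNl oct_mulNr.
    by rewrite addrCA.
  have BE : - ((al ** a) ** (be ** c)) + oct_nsq al ** (a ** c) = - B.
    by rewrite nE /B -Eb' -Ed' oct_mulNl oct_mulNr opprK opprB addrC.
  have mst : multiplicity rho (star rho f g) al = (s + t)%N.
    by rewrite ms mfs -(multiplicity_class rho g cb) mgt.
  split=> E.
    (* The zero of [f] makes N(f g) divisible by Delta, and under that condition [A = 0] forces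
       [B = 0]. *)
    have A0 : A = 0 by rewrite -AE E addNr.
    by split; [exact: (star_sph A0 (star_eq0 (or_introl dvf) A0)) | exact: mst].
  have A0 : A <> 0 by rewrite -AE addrC => /subr0_eq/esym.
  have [ga [c' i' m' E']] := star_zero (s + t)%N _ _ (or_introl dvf) BE AE A0 mst.
  by exists ga; split; [exact: c' | exact: i' | exact: m' | exact: E'].
move=> s t sph mfs mgt; split; last by rewrite ms mfs mgt.
case: sph.
  move=> /(spherical_zeroE rho0 hal hal_nonreal hf rh Ef)[a0 b0].
  by apply: star_sph; rewrite a0 b0 !oct_mul0l ?scaler0 ?addr0 ?subr0.
move=> /(spherical_zeroE rho0 hal hal_nonreal hg rk Eg)[c0 d0].
by apply: star_sph; rewrite c0 d0 !oct_mul0r ?scaler0 ?addr0 ?subr0.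
Qed.
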